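(* Let $k$ be a field. (a) The functor $\widehat\otimes^*\colon\mathsf{Top}^{\mathsf{sc}}_k\times\mathsf{Top}^{\mathsf{sc}}_k\to\mathsf{Top}^{\mathsf{sc}}_k$ preserves the cokernels of morphisms (in each of its arguments). Fixing a topological vector space in one of the arguments, it becomes an endofunctor $\mathsf{Top}^{\mathsf{sc}}_k\to\mathsf{Top}^{\mathsf{sc}}_k$ taking short sequences satisfying Ex1 to short sequences satisfying Ex1. (b) The functor $\widehat\otimes^{\leftarrow}\colon\mathsf{Top}^{\mathsf{sc}}_k\times\mathsf{Top}^{\mathsf{sc}}_k\to\mathsf{Top}^{\mathsf{sc}}_k$ preserves the cokernels of morphisms (in each of its arguments). Fixing a topological vector space in any one of the arguments, it becomes an endofunctor $\mathsf{Top}^{\mathsf{sc}}_k\to\mathsf{Top}^{\mathsf{sc}}_k$ taking short sequences satisfying Ex1 to short sequences satisfying Ex1. (c) The functor $\widehat\otimes^!\colon\mathsf{Top}^{\mathsf{sc}}_k\times\mathsf{Top}^{\mathsf{sc}}_k\to\mathsf{Top}^{\mathsf{sc}}_k$ preserves the cokernels of morphisms (in each of its arguments). Fixing a topological vector space in one of the arguments, it becomes an endofunctor $\mathsf{Top}^{\mathsf{sc}}_k\to\mathsf{Top}^{\mathsf{sc}}_k$ taking short sequences satisfying Ex1 to short sequences satisfying Ex1.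
   Context: All topological $k$-vector spaces ($k$ a fixed field with the discrete topology) have linear topology: open vector subspaces form a base of neighborhoods of zero. The completion of $V$ is $V^{\wedge}=\varprojlim_{U\subset V}V/U$ over the open subspaces $U$, topologized so that the kernels of the projections $V^{\wedge}\to V/U$ form a base of neighborhoods of zero. $V$ is separated (resp. complete) if $V\to V^{\wedge}$ is injective (resp. surjective). $\mathsf{Top}^{\mathsf{sc}}_k$ is the category of complete, separated topological $k$-vector spaces and continuous $k$-linear maps. It is additive with kernels and cokernels; the cokernel of $f\colon\mathfrak A\to\mathfrak B$ in $\mathsf{Top}^{\mathsf{sc}}_k$ is the completion of the quotient space $\mathfrak B/f(\mathfrak A)$ with the quotient topology. A short sequence $0\to A'\overset{i}\to A\overset{p}\to A''\to0$ in an additive category satisfies Ex1 if $i$ is a kernel of $p$ and $p$ is a cokernel of $i$. For topological vector spaces $U$ and $V$, three linear topologies on $U\otimes_kV$ are defined as follows; the resulting topological vector spaces are denoted by $U\otimes^*V$, $U\otimes^{\leftarrow}V$, $U\otimes^!V$. A subspace $E\subset U\otimes_kV$ is open in $U\otimes^*V$ if: there exist open subspaces $P\subset U$, $Q\subset V$ with $P\otimes_kQ\subset E$; for every $u\in U$ there is an open subspace $Q_u\subset V$ with $u\otimes Q_u\subset E$; and for every $v\in V$ there is an open subspace $P_v\subset U$ with $P_v\otimes v\subset E$. A subspace $E$ is open in $U\otimes^{\leftarrow}V$ if: there exists an open subspace $P\subset U$ with $P\otimes_kV\subset E$; and for every $u\in U$ there is an open subspace $Q_u\subset V$ with $u\otimes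 Q_u\subset E$. A subspace $E$ is open in $U\otimes^!V$ if there exist open subspaces $P\subset U$, $Q\subset V$ with $P\otimes_kV+U\otimes_kQ\subset E$. For $\mathfrak U,\mathfrak V\in\mathsf{Top}^{\mathsf{sc}}_k$ put $\mathfrak U\,\widehat\otimes^*\,\mathfrak V=(\mathfrak U\otimes^*\mathfrak V)^{\wedge}$, $\mathfrak U\,\widehat\otimes^{\leftarrow}\,\mathfrak V=(\mathfrak U\otimes^{\leftarrow}\mathfrak V)^{\wedge}$, $\mathfrak U\,\widehat\otimes^!\,\mathfrak V=(\mathfrak U\otimes^!\mathfrak V)^{\wedge}$; on morphisms, these functors are the completions of $f\otimes g$. *)

(* Defs.v *)
From HB Require Import structures.
From mathcomp Require Import all_boot all_algebra finmap.
From mathcomp Require Import boolp classical_sets functions filter topology.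
From mathcomp.multinomials Require Import monalg.

Set Implicit Arguments.
Unset Strict Implicit.
Unset Printing Implicit Defensive.

Import GRing.Theory.
Local Open Scope classical_set_scope.
Local Open Scope ring_scope.
Local Open Scope quotient_scope.

Fact submod_oppr_closed (k : fieldType) (V : lmodType k) (W : submodClosed V) :
  oppr_closed W.
Proof. by move=> x xW; rewrite -scaleN1r rpredZ. Qed.
Section Subspaces.
Context {k : fieldType} {V : lmodType k}.
Implicit Types U W : submodClosed V.

Definition mksub (p : {pred V}) (pP : submod_closed p) : submodClosed V :=
  HB.pack (p : V -> bool) (GRing.isSubmodClosed.Build k V p pP).

Fact subT_proof : submod_closed (predT : {pred V}). Proof. by split. Qed.
Definition subT := mksub subT_proof.

Fact sub0_proof : submod_closed (pred1 0 : {pred V}).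
Proof.
split=> [|a x y]; rewrite !inE// => /eqP-> /eqP->.
by rewrite scaler0 addr0.
Qed.
Definition sub0 := mksub sub0_proof.

Fact subI_proof U W : submod_closed [predI U & W].
Proof.
split=> [|a x y]; first by rewrite !inE !rpred0.
by rewrite !inE => /andP[xU xW] /andP[yU yW]; rewrite !rpredD ?rpredZ.
Qed.
Definition subI U W := mksub (subI_proof U W).

Definition lspan_pred (A : set V) : {pred V} :=
  fun x => `[< forall W, A `<=` [set` W] -> x \in W >].
Fact lspan_proof A : submod_closed (lspan_pred A).
Proof.
split=> [|a x y]; first by apply/asboolP => W _; exact: rpred0.
move=> /asboolP xA /asboolP yA; apply/asboolP => W AW.
by rewrite rpredD ?rpredZ ?xA ?yA.
Qed.
Definition lspan A := mksub (lspan_proof A).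

Lemma lspan_sub A x : A x -> x \in lspan A.
Proof. by move=> Ax; apply/asboolP => W; apply. Qed.

Lemma lspan_le A W : A `<=` [set` W] -> {subset lspan A <= W}.
Proof. by move=> AW x /asboolP; apply. Qed.

(* The library's quotients are by a [zmodClosed] predicate, from which
   [submodClosed] does not inherit. *)
Definition sub_zmod W : zmodClosed V :=
  HB.pack (GRing.SubmodClosed.sort W)
    (GRing.isOppClosed.Build V (GRing.SubmodClosed.sort W)
      (@submod_oppr_closed k V W)).

Lemma subspaceB W : {in W &, forall x y, x - y \in W}.
Proof. exact: (@rpredB V (sub_zmod W)). Qed.

Definition lquot W : Type := Quotient.quot (sub_zmod W).
HB.instance Definition _ W := GRing.Zmodule.on (lquot W).
HB.instance Definition _ W := EqQuotient.on (lquot W).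

Lemma lquotP W x y : reflect (\pi_(lquot W) x = \pi_(lquot W) y) (x - y \in W).
Proof.
by rewrite -[_ \in W]/(_ \in sub_zmod W) Quotient.idealrBE; apply: eqP.
Qed.

Lemma lquotD W x y :
  \pi_(lquot W) (x + y) = \pi_(lquot W) x + \pi_(lquot W) y.
Proof. exact: (raddfD \pi_(Quotient.quot (sub_zmod W))). Qed.

Definition lquot_scale W a (x : lquot W) : lquot W :=
  \pi_(lquot W) (a *: repr x).

Lemma lquot_scaleE W a x :
  lquot_scale a (\pi_(lquot W) x) = \pi_(lquot W) (a *: x).
Proof.
by apply/lquotP; rewrite -scalerBr rpredZ//; apply/lquotP; rewrite reprK.
Qed.

Fact lquot_scaleA W a b (x : lquot W) :
  lquot_scale a (lquot_scale b x) = lquot_scale (a * b) x.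
Proof. by rewrite -[x]reprK !lquot_scaleE scalerA reprK. Qed.
Fact lquot_scale1 W : left_id 1 (@lquot_scale W).
Proof. by move=> x; rewrite -[x]reprK !lquot_scaleE scale1r. Qed.
Fact lquot_scaleDr W : right_distributive (@lquot_scale W) +%R.
Proof.
move=> a x y; rewrite -[x]reprK -[y]reprK -lquotD !lquot_scaleE -lquotD.
by rewrite scalerDr.
Qed.
Fact lquot_scaleDl W (x : lquot W) : {morph (@lquot_scale W)^~ x : a b / a + b}.
Proof. by move=> a b; rewrite -[x]reprK !lquot_scaleE -lquotD scalerDl. Qed.
HB.instance Definition _ W := GRing.Zmodule_isLmodule.Build k (lquot W)
  (@lquot_scaleA W) (@lquot_scale1 W) (@lquot_scaleDr W) (@lquot_scaleDl W).

Lemma lquotZ W a x : \pi_(lquot W) (a *: x) = a *: \pi_(lquot W) x.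
Proof. exact: (esym (lquot_scaleE W a x)). Qed.

Lemma lquot0 W : \pi_(lquot W) 0 = 0.
Proof. by rewrite -(scale0r 0) lquotZ scale0r. Qed.

Lemma lquot_eq0 W x : \pi_(lquot W) x = 0 <-> x \in W.
Proof. by rewrite -(lquot0 W) -[in _ \in _](subr0 x); split=> /lquotP. Qed.

Lemma repr_lquot W x : repr (\pi_(lquot W) x) - x \in W.
Proof. by apply/lquotP; rewrite reprK. Qed.

End Subspaces.

Section Preimage.
Context {k : fieldType} {V W : lmodType k}.

Fact presub_proof (f : {linear V -> W}) (U : submodClosed W) :
  submod_closed [pred x | f x \in U].
Proof.
split=> [|a x y]; first by rewrite inE linear0 rpred0.
by rewrite !inE => xU yU; rewrite linearP rpredD ?rpredZ.
Qed.
Definition presub f U := mksub (presub_proof f U).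

Lemma presubE f U x : (x \in presub f U) = (f x \in U). Proof. by []. Qed.

End Preimage.

(* [k] is discrete, so that joint continuity of scaling on [k * V] amounts to
   continuity of scaling by each scalar. The classes of [tvs] are not used
   because their modules are over a [numDomainType]. *)
HB.mixin Record isLinearTopology (k : fieldType) V
    of Topological V & GRing.Lmodule k V := {
  add_continuous : continuous (fun x : V * V => x.1 + x.2);
  scale_continuous : forall a : k, continuous (fun x : V => a *: x);
  nbhs0_subspace : forall A : set V, nbhs (0 : V) A ->
    exists2 U : submodClosed V, open [set` U] & [set` U] `<=` A
}.

#[short(type="linTopType")]
HB.structure Definition LinTop (k : fieldType) :=
  {V of Topological V & GRing.Lmodule k V & isLinearTopology k V}.

(* The linear topology in which the subspaces satisfying [opbase] form a base
   of neighborhoods of zero. *)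
HB.factory Record hasOpenSubspaceBase (k : fieldType) V of GRing.Lmodule k V := {
  opbase : submodClosed V -> Prop;
  opbase_ex : exists U, opbase U;
  opbaseI : forall U W, opbase U -> opbase W ->
    exists2 X, opbase X & {subset X <= U} /\ {subset X <= W}
}.

HB.builders Context k V of hasOpenSubspaceBase k V.

Definition nbhs_of_opbase (x : V) (A : set V) :=
  exists2 U, opbase U & forall y, y - x \in U -> A y.

HB.instance Definition _ := hasNbhs.Build V nbhs_of_opbase.

Fact nbhs_opbase_filter (x : V) : ProperFilter (nbhs x).
Proof.
apply: Build_ProperFilter_ex.
  by move=> A [U _ UA]; exists x; apply: UA; rewrite subrr rpred0.
split.
- by have [U bU] := opbase_ex; exists U.
- move=> A B [U bU UA] [W bW WB]; have [X bX [XU XW]] := opbaseI bU bW.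
  by exists X => // y yX; split; [apply/UA/XU | apply/WB/XW].
- by move=> A B AB [U bU UA]; exists U => // y /UA /AB.
Qed.

Fact nbhs_opbase_singleton (x : V) (A : set V) : nbhs x A -> A x.
Proof. by move=> [U _ UA]; apply: UA; rewrite subrr rpred0. Qed.

Fact nbhs_opbase_nbhs (x : V) (A : set V) : nbhs x A -> nbhs x (nbhs^~ A).
Proof.
move=> [U bU UA]; exists U => // y yU; exists U => // z zU; apply: UA.
by rewrite -(subrKA y) rpredD.
Qed.

HB.instance Definition _ := Nbhs_isNbhsTopological.Build V
  nbhs_opbase_filter nbhs_opbase_singleton nbhs_opbase_nbhs.

Fact opbase_add_continuous : continuous (fun x : V * V => x.1 + x.2).
Proof.
move=> [x y] A [U bU UA].
exists ([set z | z - x \in U], [set z | z - y \in U]) => /=.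
  by split; exists U.
move=> [z t] [/= zU tU]; apply: UA => /=.
by rewrite opprD addrACA rpredD.
Qed.

Fact opbase_scale_continuous (a : k) : continuous (fun x : V => a *: x).
Proof.
move=> x A [U bU UA]; exists U => // y yU; apply: UA.
by rewrite -scalerBr rpredZ.
Qed.

Fact opbase_nbhs0 (A : set V) : nbhs (0 : V) A ->
  exists2 U : submodClosed V, open [set` U] & [set` U] `<=` A.
Proof.
move=> [U bU UA]; exists U; last by move=> x xU; apply: UA; rewrite subr0.
rewrite openE => x /= xU; exists U => // y yU /=.
by rewrite -(subrK x y) rpredD.
Qed.

HB.instance Definition _ := isLinearTopology.Build k V
  opbase_add_continuous opbase_scale_continuous opbase_nbhs0.
HB.end.

Section LinTopTheory.
Context {k : fieldType}.
Implicit Types V W : linTopType k.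

Lemma nbhs_subspaceP V (x : V) (A : set V) : nbhs x A <->
  exists2 U : submodClosed V, open [set` U] & forall y, y - x \in U -> A y.
Proof.
have sh (c d : V) (B : set V) : nbhs (c + d) B -> nbhs c [set y | B (y + d)].
  move=> cB; have /= := @add_continuous k V (c, d) B cB.
  case=> -[P Q] /= [cP dQ] PQ; apply: filterS cP => y Py.
  by apply: (PQ (y, d)); split=> //=; apply: nbhs_singleton dQ.
split=> [xA|[U oU UA]].
  have /nbhs0_subspace[U oU UA] : nbhs 0 [set y | A (y + x)].
    by apply: sh; rewrite add0r.
  by exists U => // y /UA /=; rewrite subrK.
suff : nbhs x [set y | [set` U] (y - x)] by apply: filterS => y /UA.
by apply: sh; rewrite subrr; apply: open_nbhs_nbhs; split=> //=; apply: rpred0.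
Qed.

Lemma open_subspaceP V (W : submodClosed V) :
  open [set` W] <-> exists2 U : submodClosed V, open [set` U] & {subset U <= W}.
Proof.
split=> [oW|[U oU UW]]; first by exists W.
rewrite openE => x /= xW; apply/nbhs_subspaceP; exists U => // y /UW yW /=.
by rewrite -(subrK x y) rpredD.
Qed.

Lemma linear_continuousP V W (f : {linear V -> W}) : continuous f <->
  forall U : submodClosed W, open [set` U] -> open [set` presub f U].
Proof.
split=> [fc U oU|fo x A].
  by have /continuousP/(_ _ oU) := fc.
move=> /nbhs_subspaceP[U oU UA]; apply/nbhs_subspaceP.
exists (presub f U); first exact: fo.
by move=> y; rewrite inE linearB => /UA.
Qed.

End LinTopTheory.

Record opensub (k : fieldType) (V : linTopType k) := OpenSub {
  opensub_sub :> submodClosed V;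
  opensub_open : open [set` opensub_sub]
}.

Section OpenSubspaces.
Context {k : fieldType}.
Implicit Types V W : linTopType k.

Fact opensubT_open V : open [set` @subT k V].
Proof. by have -> : [set` @subT k V] = setT; [exact/seteqP | exact: openT]. Qed.
Definition opensubT V := OpenSub (@opensubT_open V).

Fact opensubI_open V (U W : opensub V) : open [set` subI U W].
Proof.
have -> : [set` subI U W] = [set` U] `&` [set` W].
  apply/seteqP; split=> x /=; first by move=> /andP.
  by move=> [xU xW]; apply/andP.
by apply: openI; exact: opensub_open.
Qed.
Definition opensubI V (U W : opensub V) := OpenSub (opensubI_open U W).

End OpenSubspaces.

Record hom (k : fieldType) (V W : linTopType k) := Hom {
  hom_fun :> {linear V -> W};
  hom_continuous : continuous hom_fun
}.

Section Homs.
Context {k : fieldType}.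
Implicit Types U V W : linTopType k.

Lemma hom_ext V W (f g : hom V W) : f =1 g -> f = g.
Proof.
case: f g => [f fc] [g gc] /= /funext fg.
have {}fg : f = g.
  case: f g {fc gc} fg => f [[cf] [df]] [g [[cg] [dg]]] /= fg.
  case: _ / fg in cg dg *.
  by rewrite (Prop_irrelevance cf cg) (Prop_irrelevance df dg).
by case: _ / fg in gc *; rewrite (Prop_irrelevance fc gc).
Qed.

Fact hom_id_continuous V : continuous (idfun : {linear V -> V}).
Proof. by move=> x. Qed.
Definition hom_id V : hom V V := Hom (@hom_id_continuous V).

Fact hom_comp_continuous U V W (g : hom V W) (f : hom U V) :
  continuous (g \o f : {linear U -> W}).
Proof. by move=> x; apply: continuous_comp; exact: hom_continuous. Qed.
Definition hom_comp U V W (g : hom V W) (f : hom U V) : hom U W :=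
  Hom (hom_comp_continuous (g := g) (f := f)).

Fact hom_zero_continuous V W : continuous (\0 : {linear V -> W}).
Proof. by move=> x; exact: cvg_cst. Qed.
Definition hom_zero V W : hom V W := Hom (@hom_zero_continuous V W).

Definition opensub_pre V W (f : hom V W) (U : opensub W) : opensub V :=
  OpenSub (proj1 (linear_continuousP f) (@hom_continuous _ _ _ f) U
    (@opensub_open _ _ U)).

End Homs.

Section Completion.
Context {k : fieldType} (V : linTopType k).
Implicit Types U W : opensub V.

(* The projective limit of the [V / U]: for [U] contained in [W],
   [\pi (repr z)] is the image of [z : V / U] in [V / W]. *)
Record completion := Completion {
  pr : forall U : opensub V, lquot U;
  pr_compat : forall U W, {subset U <= W} -> \pi_(lquot W) (repr (pr U)) = pr W
}.

Lemma completion_ext (x y : completion) : (forall U, pr x U = pr y U) -> x = y.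
Proof.
case: x y => [x xc] [y yc] xy.
have E : x = y by apply: functional_extensionality_dep.
by case: _ / E in yc {xy} *; rewrite (Prop_irrelevance xc yc).
Qed.

Lemma lquot_transE (U W : submodClosed V) v : {subset U <= W} ->
  \pi_(lquot W) (repr (\pi_(lquot U) v)) = \pi_(lquot W) v.
Proof. by move=> UW; apply/lquotP/UW/repr_lquot. Qed.

HB.instance Definition _ := gen_eqMixin completion.
HB.instance Definition _ := gen_choiceMixin completion.

Fact completion0_compat U W : {subset U <= W} ->
  \pi_(lquot W) (repr (0 : lquot U)) = 0.
Proof. by move=> UW; rewrite -lquot0 lquot_transE// lquot0. Qed.
Definition completion0 := Completion completion0_compat.

Fact completionD_compat (x y : completion) U W : {subset U <= W} ->
  \pi_(lquot W) (repr (pr x U + pr y U)) = pr x W + pr y W.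
Proof.
move=> UW; rewrite -(reprK (pr x U)) -(reprK (pr y U)) -lquotD lquot_transE//.
by rewrite lquotD !pr_compat.
Qed.
Definition completionD x y := Completion (@completionD_compat x y).

Fact completionZ_compat a (x : completion) U W : {subset U <= W} ->
  \pi_(lquot W) (repr (a *: pr x U)) = a *: pr x W.
Proof.
move=> UW; rewrite -(reprK (pr x U)) -lquotZ lquot_transE//.
by rewrite lquotZ pr_compat.
Qed.
Definition completionZ a x := Completion (@completionZ_compat a x).

Fact completionDA : associative completionD.
Proof. by move=> x y z; apply: completion_ext => U; exact: addrA. Qed.
Fact completionDC : commutative completionD.
Proof. by move=> x y; apply: completion_ext => U; exact: addrC. Qed.
Fact completion0D : left_id completion0 completionD.
Proof. by move=> x; apply: completion_ext => U; exact: add0r. Qed.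
Fact completionND : left_inverse completion0 (completionZ (-1)) completionD.
Proof. by move=> x; apply: completion_ext => U /=; rewrite scaleN1r addNr. Qed.
HB.instance Definition _ := GRing.isZmodule.Build completion
  completionDA completionDC completion0D completionND.

Fact completionZA a b x :
  completionZ a (completionZ b x) = completionZ (a * b) x.
Proof. by apply: completion_ext => U; exact: scalerA. Qed.
Fact completion1Z : left_id 1 completionZ.
Proof. by move=> x; apply: completion_ext => U; exact: scale1r. Qed.
Fact completionZDr : right_distributive completionZ +%R.
Proof. by move=> a x y; apply: completion_ext => U; exact: scalerDr. Qed.
Fact completionZDl x : {morph completionZ^~ x : a b / a + b}.
Proof. by move=> a b; apply: completion_ext => U; exact: scalerDl. Qed.
HB.instance Definition _ := GRing.Zmodule_isLmodule.Build k completion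
  completionZA completion1Z completionZDr completionZDl.

Lemma prD x y U : pr (x + y) U = pr x U + pr y U. Proof. by []. Qed.
Lemma prZ a x U : pr (a *: x) U = a *: pr x U. Proof. by []. Qed.
Lemma prB x y U : pr (x - y) U = pr x U - pr y U.
Proof. by rewrite -scaleN1r prD prZ scaleN1r. Qed.

Fact kerpr_proof U : submod_closed [pred x : completion | pr x U == 0].
Proof.
split=> [|a x y]; first by rewrite inE.
by rewrite !inE prD prZ => /eqP-> /eqP->; rewrite scaler0 addr0.
Qed.
Definition kerpr U := mksub (kerpr_proof U).

Lemma kerprP U x : reflect (pr x U = 0) (x \in kerpr U).
Proof. exact: eqP. Qed.

Lemma kerprS U W : {subset U <= W} -> {subset kerpr U <= kerpr W}.
Proof.
move=> UW x /kerprP xU; apply/kerprP.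
by rewrite -(pr_compat _ UW) xU -lquot0 lquot_transE// lquot0.
Qed.

Definition completion_opbase (K : submodClosed completion) :=
  exists U, K = kerpr U.

Fact completion_opbase_ex : exists K, completion_opbase K.
Proof. by exists (kerpr (opensubT V)), (opensubT V). Qed.
Fact completion_opbaseI K L : completion_opbase K -> completion_opbase L ->
  exists2 M, completion_opbase M & {subset M <= K} /\ {subset M <= L}.
Proof.
move=> [U ->] [W ->].
exists (kerpr (opensubI U W)); first by exists (opensubI U W).
by split; apply: kerprS => x /andP[].
Qed.
HB.instance Definition _ := hasOpenSubspaceBase.Build k completion
  completion_opbase_ex completion_opbaseI.

Lemma open_completionP (K : submodClosed completion) :
  open [set` K] <-> exists U, {subset kerpr U <= K}.
Proof.
split=> [oK|[U UK]].
  have : nbhs (0 : completion) [set` K].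
    by apply: open_nbhs_nbhs; split=> //=; exact: rpred0.
  by move=> [_ [U ->] UK]; exists U => x xU; apply: UK; rewrite subr0.
rewrite openE => x /= xK; exists (kerpr U); first by exists U.
by move=> y /UK yK /=; rewrite -(subrK x y) rpredD.
Qed.

Fact kerpr_open U : open [set` kerpr U].
Proof. by apply/open_completionP; exists U. Qed.
Definition opensub_kerpr U := OpenSub (@kerpr_open U).

Fact to_completion_compat v U W : {subset U <= W} ->
  \pi_(lquot W) (repr (\pi_(lquot U) v)) = \pi_(lquot W) v.
Proof. exact: lquot_transE. Qed.
Definition to_completion (v : V) : completion :=
  Completion (@to_completion_compat v).

Fact to_completion_linear : linear to_completion.
Proof. by move=> a x y; apply: completion_ext => U /=; rewrite lquotD lquotZ. Qed.
HB.instance Definition _ :=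
  GRing.isLinear.Build k V completion *:%R to_completion to_completion_linear.

Definition separated := injective to_completion.
Definition complete := forall y, exists x, to_completion x = y.

End Completion.

HB.mixin Record isSeparatedComplete (k : fieldType) V of LinTop k V := {
  to_completion_inj : separated V;
  to_completion_surj : complete V
}.

#[short(type="topSCType")]
HB.structure Definition TopSC (k : fieldType) :=
  {V of LinTop k V & isSeparatedComplete k V}.

Section CompletionIsComplete.
Context {k : fieldType} (V : linTopType k).

Fact completion_separated : separated (completion V).
Proof.
move=> x y xy; apply: completion_ext => U.
have /lquotP/kerprP := congr1 (fun z => pr z (opensub_kerpr U)) xy.
by rewrite prB => /subr0_eq.
Qed.

Fact completion_complete : complete (completion V).
Proof.
move=> y; pose r (U : opensub V) := repr (pr y (opensub_kerpr U)).
have rE (U W : opensub V) : {subset U <= W} -> pr (r U) W = pr (r W) W.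
  move=> UW; suff /lquotP/kerprP : \pi_(lquot (opensub_kerpr W)) (r U) =
      \pi_(lquot (opensub_kerpr W)) (r W) by rewrite prB => /subr0_eq.
  by rewrite reprK; apply: pr_compat; apply: kerprS.
have xc (U W : opensub V) : {subset U <= W} ->
    \pi_(lquot W) (repr (pr (r U) U)) = pr (r W) W.
  by move=> UW; rewrite pr_compat// rE.
exists (Completion xc); apply: completion_ext => K /=.
have /open_completionP[U UK] := opensub_open K.
rewrite -(@pr_compat _ _ y (opensub_kerpr U) K)//; apply/lquotP/UK/kerprP.
by rewrite prB subrr.
Qed.

HB.instance Definition _ := isSeparatedComplete.Build k (completion V)
  completion_separated completion_complete.

End CompletionIsComplete.

Section CompletionFunctor.
Context {k : fieldType}.
Implicit Types V W : linTopType k.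

Section Map.
Context {V W : linTopType k} (f : hom V W).

Fact completion_map_compat (x : completion V) (U X : opensub W) :
  {subset U <= X} ->
  \pi_(lquot X) (repr (\pi_(lquot U) (f (repr (pr x (opensub_pre f U)))))) =
  \pi_(lquot X) (f (repr (pr x (opensub_pre f X)))).
Proof.
move=> UX; rewrite lquot_transE//; apply/lquotP; rewrite -linearB.
rewrite -[_ \in X]/(_ \in (opensub_pre f X)); apply/lquotP; rewrite reprK.
by apply: pr_compat => v /UX.
Qed.
(* The component in [W / U] is the image of that in [V / (f @^-1` U)]. *)
Definition completion_map_fun (x : completion V) : completion W :=
  Completion (@completion_map_compat x).

Lemma pr_completion_map x U v : pr x (opensub_pre f U) = \pi_(lquot _) v ->
  pr (completion_map_fun x) U = \pi_(lquot U) (f v).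
Proof.
move=> /= ->; apply/lquotP; rewrite -linearB.
exact: (@repr_lquot _ _ (opensub_pre f U)).
Qed.

Fact completion_map_linear : linear completion_map_fun.
Proof.
move=> a x y; apply: completion_ext => U.
rewrite (@pr_completion_map _ _
  (a *: repr (pr x (opensub_pre f U)) + repr (pr y (opensub_pre f U)))).
  by rewrite linearP lquotD lquotZ.
by rewrite prD prZ lquotD lquotZ !reprK.
Qed.
HB.instance Definition _ := GRing.isLinear.Build k (completion V) (completion W)
  *:%R completion_map_fun completion_map_linear.

Fact completion_map_continuous : continuous completion_map_fun.
Proof.
apply/linear_continuousP => K /open_completionP[U UK].
apply/open_completionP; exists (opensub_pre f U) => x /kerprP x0.
apply: UK; apply/kerprP.
by rewrite (@pr_completion_map _ _ 0) ?linear0 ?lquot0.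
Qed.
Definition completion_map : hom (completion V) (completion W) :=
  Hom completion_map_continuous.

End Map.

Lemma completion_map_id V : completion_map (hom_id V) = hom_id (completion V).
Proof.
apply: hom_ext => x; apply: completion_ext => U.
rewrite (@pr_completion_map _ _ _ _ _ (repr (pr x U))); first exact: reprK.
by symmetry; apply: pr_compat.
Qed.

Lemma completion_map_comp V W X (g : hom W X) (f : hom V W) :
  completion_map (hom_comp g f) = hom_comp (completion_map g) (completion_map f).
Proof.
apply: hom_ext => x; apply: completion_ext => U; symmetry.
apply: (@pr_completion_map _ _ g (completion_map f x) U
  (f (repr (pr x (opensub_pre (hom_comp g f) U))))).
apply: pr_completion_map; symmetry; exact: pr_compat.
Qed.

Lemma completion_map_to_completion V W (f : hom V W) (v : V) :
  completion_map f (to_completion v) = to_completion (f v).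
Proof. by apply: completion_ext => U; apply: pr_completion_map. Qed.

End CompletionFunctor.

Section FreeModule.
Context {k : fieldType} {K : choiceType} {W : lmodType k}.

Definition malg_lift (h : K -> W) (g : {malg k[K]}) : W :=
  \sum_(x <- msupp g) g@_x *: h x.

Lemma malg_liftEw (h : K -> W) (d : {fset K}) (g : {malg k[K]}) :
  (msupp g `<=` d)%fset -> malg_lift h g = \sum_(x <- d) g@_x *: h x.
Proof.
move=> gd; apply: big_fset_incl => // x _ /mcoeff_outdom ->.
exact: scale0r.
Qed.

Fact malg_lift_linear h : linear (malg_lift h).
Proof.
move=> a x y; pose d := (msupp x `|` msupp y `|` msupp (a *: x + y))%fset.
have xd : (msupp x `<=` d)%fset by rewrite /d -fsetUA fsubsetUl.
have yd : (msupp y `<=` d)%fset by rewrite /d fsetUAC fsubsetUr.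
rewrite (malg_liftEw h xd) (malg_liftEw h yd) (@malg_liftEw h d) ?fsubsetUr//.
rewrite scaler_sumr -big_split; apply: eq_bigr => z _ /=.
by rewrite mcoeffD mcoeffZ scalerDl scalerA.
Qed.
HB.instance Definition _ h :=
  GRing.isLinear.Build k {malg k[K]} W *:%R (malg_lift h) (malg_lift_linear h).

Lemma malg_liftU h x : malg_lift h << x >> = h x.
Proof.
rewrite (@malg_liftEw _ [fset x]%fset) ?msuppU_le// big_seq_fset1 mcoeffUU.
exact: scale1r.
Qed.

End FreeModule.

Section Tensor.
Context {k : fieldType} (U V : lmodType k).

Definition tensor_rel : set {malg k[(U * V)%type]} := fun z =>
  (exists a u u' v,
    z = << (a *: u + u', v) >> - a *: << (u, v) >> - << (u', v) >>) \/
  (exists a u v v',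
    z = << (u, a *: v + v') >> - a *: << (u, v) >> - << (u, v') >>).

Definition tensor : Type := lquot (lspan tensor_rel).
HB.instance Definition _ := GRing.Lmodule.on tensor.

End Tensor.

Section TensorTheory.
Context {k : fieldType}.

Section Pure.
Context {U V : lmodType k}.

Definition tprod (u : U) (v : V) : tensor U V :=
  \pi_(lquot (lspan (@tensor_rel k U V))) << (u, v) >>.

Lemma tprodPl a u u' v : tprod (a *: u + u') v = a *: tprod u v + tprod u' v.
Proof.
rewrite /tprod -lquotZ -lquotD; apply/lquotP/lspan_sub; left.
by exists a, u, u', v; rewrite opprD addrA.
Qed.

Lemma tprodPr a u v v' : tprod u (a *: v + v') = a *: tprod u v + tprod u v'.
Proof.
rewrite /tprod -lquotZ -lquotD; apply/lquotP/lspan_sub; right.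
by exists a, u, v, v'; rewrite opprD addrA.
Qed.

(* Over a field, [P \otimes Q] embeds in [U \otimes V] with this image. *)
Definition tensor_sub (P : submodClosed U) (Q : submodClosed V) :
  submodClosed (tensor U V) :=
  lspan [set tprod p q | p in [set` P] & q in [set` Q]].

Lemma tensor_subP P Q (E : submodClosed (tensor U V)) :
  {subset tensor_sub P Q <= E} <->
  forall p q, p \in P -> q \in Q -> tprod p q \in E.
Proof.
split=> [PQ p q pP qQ|PQ]; first by apply/PQ/lspan_sub; exists p => //; exists q.
by apply: lspan_le => _ [p pP [q qQ <-]]; apply: PQ.
Qed.

Section Lift.
Context {W : lmodType k} (h : U -> V -> W).
Hypothesis hl : forall v, linear (h^~ v).
Hypothesis hr : forall u, linear (h u).

Definition tensor_lift (x : tensor U V) : W :=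
  malg_lift (fun p => h p.1 p.2) (repr x).

Lemma tensor_liftE z :
  tensor_lift (\pi_(lquot (lspan (@tensor_rel k U V))) z) =
  malg_lift (fun p => h p.1 p.2) z.
Proof.
apply/eqP; rewrite -subr_eq0 -linearB.
pose K := presub (malg_lift (fun p => h p.1 p.2)) sub0.
suff : {subset lspan (@tensor_rel k U V) <= K} by apply; exact: repr_lquot.
apply: lspan_le => y yr /=; rewrite inE.
case: yr => [] [a [u [v [w ->]]]]; rewrite !linearB linearZ /= !malg_liftU /=.
  by have /= -> := hl w a u v; rewrite addrAC addrK subrr inE.
by have /= -> := hr u a v w; rewrite addrAC addrK subrr inE.
Qed.

Fact tensor_lift_linear : linear tensor_lift.
Proof.
move=> a x y; rewrite -(reprK x) -(reprK y) -lquotZ -lquotD !tensor_liftE.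
exact: linearP.
Qed.

Lemma tensor_lift_tprod u v : tensor_lift (tprod u v) = h u v.
Proof. by rewrite tensor_liftE malg_liftU. Qed.

End Lift.

Lemma tensor_ind (P : tensor U V -> Prop) : P 0 ->
  (forall a u v x, P x -> P (a *: tprod u v + x)) -> forall x, P x.
Proof.
move=> P0 PD x; rewrite -(reprK x) [repr x]monalgE.
elim/big_rec: _ => [|[u v] y _ Py]; first by rewrite lquot0.
rewrite lquotD.
have -> : << (repr x)@_(u, v) *g (u, v) >> =
    (repr x)@_(u, v) *: << (u, v) >> :> {malg k[(U * V)%type]}.
  by apply/malgP => p; rewrite mcoeffZ !mcoeffU mulr_natr.
by rewrite lquotZ; apply: PD.
Qed.

End Pure.

Section Map.
Context {U V U' V' : lmodType k} (f : {linear U -> U'}) (g : {linear V -> V'}).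

Definition tensor_map : tensor U V -> tensor U' V' :=
  tensor_lift (fun u v => tprod (f u) (g v)).

Fact tensor_map_bilinl v : linear (fun u => tprod (f u) (g v)).
Proof. by move=> a x y; rewrite linearP tprodPl. Qed.
Fact tensor_map_bilinr u : linear (fun v => tprod (f u) (g v)).
Proof. by move=> a x y; rewrite linearP tprodPr. Qed.

HB.instance Definition _ := GRing.isLinear.Build k (tensor U V) (tensor U' V')
  *:%R tensor_map (tensor_lift_linear tensor_map_bilinl tensor_map_bilinr).

Lemma tensor_map_tprod u v : tensor_map (tprod u v) = tprod (f u) (g v).
Proof. exact: (tensor_lift_tprod tensor_map_bilinl tensor_map_bilinr). Qed.

Lemma presub_tprod (E : submodClosed (tensor U' V')) u v :
  (tprod u v \in presub tensor_map E) = (tprod (f u) (g v) \in E).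
Proof. by rewrite presubE /= tensor_map_tprod. Qed.

End Map.

End TensorTheory.

(* A rule declaring certain subspaces of each [U \otimes V] to be open, so as
   to define a linear topology that is functorial in [U] and [V] *)
Record tensor_topology (k : fieldType) := TensorTopology {
  topen : forall U V : linTopType k, submodClosed (tensor U V) -> Prop;
  topenT : forall U V : linTopType k, @topen U V (@subT k (tensor U V));
  topenI : forall (U V : linTopType k) (E F : submodClosed (tensor U V)),
    topen E -> topen F -> topen (subI E F);
  topenS : forall (U V : linTopType k) (E F : submodClosed (tensor U V)),
    {subset E <= F} -> topen E -> topen F;
  topen_pre : forall (U V U' V' : linTopType k) (f : hom U U') (g : hom V V') E,
    topen E -> topen (presub (tensor_map f g) E)
}.

Definition ttensor (k : fieldType) (T : tensor_topology k) (U V : linTopType k)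
  : Type := tensor U V.

Section TopologizedTensor.
Context {k : fieldType} (T : tensor_topology k).

Section Objects.
Context (U V : linTopType k).

HB.instance Definition _ := GRing.Lmodule.on (ttensor T U V).

Let opbase (E : submodClosed (ttensor T U V)) := topen T E.
Fact ttensor_base_ex : exists E, opbase E.
Proof. by exists subT; exact: topenT. Qed.
Fact ttensor_baseI E F : opbase E -> opbase F ->
  exists2 G, opbase G & {subset G <= E} /\ {subset G <= F}.
Proof.
move=> oE oF; exists (subI E F); first exact: topenI.
by split=> x /andP[].
Qed.
HB.instance Definition _ := hasOpenSubspaceBase.Build k (ttensor T U V)
  ttensor_base_ex ttensor_baseI.

Lemma open_ttensorP (E : submodClosed (ttensor T U V)) :
  open [set` E] <-> topen T E.
Proof.
split=> [oE|oE].
  have : nbhs (0 : ttensor T U V) [set` E].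
    by apply: open_nbhs_nbhs; split=> //=; exact: rpred0.
  by move=> [F oF FE]; apply: topenS oF => x xF; apply: FE; rewrite subr0.
rewrite openE => x /= xE; exists E => // y yE /=.
by rewrite -(subrK x y) rpredD.
Qed.

End Objects.

Section Morphisms.
Context {U V U' V' : linTopType k} (f : hom U U') (g : hom V V').

Fact ttensor_map_continuous :
  continuous (tensor_map f g : {linear ttensor T U V -> ttensor T U' V'}).
Proof.
apply/linear_continuousP => E /open_ttensorP oE; apply/open_ttensorP.
exact: topen_pre.
Qed.
Definition ttensor_map : hom (ttensor T U V) (ttensor T U' V') :=
  Hom ttensor_map_continuous.

End Morphisms.

Lemma ttensor_map_id U V :
  ttensor_map (hom_id U) (hom_id V) = hom_id (ttensor T U V).
Proof.
apply: hom_ext; elim/(@tensor_ind k U V) => [|a u v x IH]; first by rewrite !linear0.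
by rewrite !linearP IH /= tensor_map_tprod.
Qed.

Lemma ttensor_map_comp (U V U' V' U'' V'' : linTopType k)
    (f' : hom U' U'') (f : hom U U') (g' : hom V' V'') (g : hom V V') :
  ttensor_map (hom_comp f' f) (hom_comp g' g) =
  hom_comp (ttensor_map f' g') (ttensor_map f g).
Proof.
apply: hom_ext; elim/(@tensor_ind k U V) => [|a u v x IH]; first by rewrite !linear0.
by rewrite !linearP IH /= !tensor_map_tprod.
Qed.

End TopologizedTensor.

Section ThreeTopologies.
Context {k : fieldType}.

Section Definitions.
Context {U V : linTopType k}.
Implicit Type E : submodClosed (tensor U V).

(* The open subspaces of [U \otimes^* V], [U \otimes^{\leftarrow} V] and
   [U \otimes^! V] respectively *)
Definition star_open E := [/\
  exists (P : opensub U) (Q : opensub V), {subset tensor_sub P Q <= E},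
  forall u, exists Q : opensub V, [set tprod u q | q in [set` Q]] `<=` [set` E] &
  forall v, exists P : opensub U, [set tprod p v | p in [set` P]] `<=` [set` E]].

Definition left_open E :=
  (exists P : opensub U, {subset tensor_sub P (@subT k V) <= E}) /\
  (forall u, exists Q : opensub V, [set tprod u q | q in [set` Q]] `<=` [set` E]).

Definition shriek_open E :=
  exists (P : opensub U) (Q : opensub V), forall x y,
    x \in tensor_sub P (@subT k V) -> y \in tensor_sub (@subT k U) Q ->
    x + y \in E.

End Definitions.

Implicit Types U V : linTopType k.

Fact star_openT U V : star_open (@subT k (tensor U V)).
Proof.
split; first by exists (opensubT U), (opensubT V).
  by move=> u; exists (opensubT V).
by move=> v; exists (opensubT U).
Qed.

Fact star_openI U V (E F : submodClosed (tensor U V)) :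
  star_open E -> star_open F -> star_open (subI E F).
Proof.
move=> [[P [Q PQE]] QE PE] [[P' [Q' PQF]] QF PF]; split.
- exists (opensubI P P'), (opensubI Q Q'); apply/tensor_subP => p q.
  move=> /andP[pP pP'] /andP[qQ qQ']; apply/andP; split.
    by move/tensor_subP: PQE; apply.
  by move/tensor_subP: PQF; apply.
- move=> u; have [X XE] := QE u; have [Y YF] := QF u.
  exists (opensubI X Y) => _ [q /andP[qX qY] <-]; apply/andP.
  by split; [apply: XE | apply: YF]; exists q.
- move=> v; have [X XE] := PE v; have [Y YF] := PF v.
  exists (opensubI X Y) => _ [q /andP[qX qY] <-]; apply/andP.
  by split; [apply: XE | apply: YF]; exists q.
Qed.

Fact star_openS U V (E F : submodClosed (tensor U V)) :
  {subset E <= F} -> star_open E -> star_open F.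
Proof.
move=> EF [[P [Q PQE]] QE PE]; split.
- by exists P, Q => x /PQE /EF.
- by move=> u; have [Q' Q'E] := QE u; exists Q' => x /Q'E /EF.
- by move=> v; have [P' P'E] := PE v; exists P' => x /P'E /EF.
Qed.

Fact star_open_pre U V U' V' (f : hom U U') (g : hom V V') E :
  star_open E -> star_open (presub (tensor_map f g) E).
Proof.
move=> [[P [Q PQE]] QE PE]; split.
- exists (opensub_pre f P), (opensub_pre g Q); apply/tensor_subP => p q pP qQ.
  rewrite presub_tprod; move/tensor_subP: PQE; exact.
- move=> u; have [X XE] := QE (f u); exists (opensub_pre g X).
  move=> _ [q qX <-] /=; rewrite presub_tprod.
  by apply: XE; exists (g q).
- move=> v; have [X XE] := PE (g v); exists (opensub_pre f X).
  move=> _ [p pX <-] /=; rewrite presub_tprod.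
  by apply: XE; exists (f p).
Qed.

Definition star_topology := TensorTopology
  star_openT star_openI star_openS star_open_pre.

Fact left_openT U V : left_open (@subT k (tensor U V)).
Proof.
by split; [exists (opensubT U) | move=> u; exists (opensubT V)].
Qed.

Fact left_openI U V (E F : submodClosed (tensor U V)) :
  left_open E -> left_open F -> left_open (subI E F).
Proof.
move=> [[P PE] QE] [[P' PF] QF]; split.
- exists (opensubI P P'); apply/tensor_subP => p q.
  move=> /andP[pP pP'] qT; apply/andP; split.
    by move/tensor_subP: PE; apply.
  by move/tensor_subP: PF; apply.
- move=> u; have [X XE] := QE u; have [Y YF] := QF u.
  exists (opensubI X Y) => _ [q /andP[qX qY] <-]; apply/andP.
  by split; [apply: XE | apply: YF]; exists q.
Qed.

Fact left_openS U V (E F : submodClosed (tensor U V)) :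
  {subset E <= F} -> left_open E -> left_open F.
Proof.
move=> EF [[P PE] QE]; split; first by exists P => x /PE /EF.
by move=> u; have [Q' Q'E] := QE u; exists Q' => x /Q'E /EF.
Qed.

Fact left_open_pre U V U' V' (f : hom U U') (g : hom V V') E :
  left_open E -> left_open (presub (tensor_map f g) E).
Proof.
move=> [[P PE] QE]; split.
- exists (opensub_pre f P); apply/tensor_subP => p q pP _.
  by rewrite presub_tprod; move/tensor_subP: PE; apply.
- move=> u; have [X XE] := QE (f u); exists (opensub_pre g X).
  move=> _ [q qX <-] /=; rewrite presub_tprod.
  by apply: XE; exists (g q).
Qed.

Definition left_topology := TensorTopology
  left_openT left_openI left_openS left_open_pre.

Lemma shriek_openP U V (E : submodClosed (tensor U V)) : shriek_open E <->
  exists (P : opensub U) (Q : opensub V),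
    {subset tensor_sub P (@subT k V) <= E} /\
    {subset tensor_sub (@subT k U) Q <= E}.
Proof.
split=> [[P [Q PQE]]|[P [Q [PE QE]]]]; exists P, Q.
  split=> x xE; first by rewrite -[x]addr0 PQE// rpred0.
  by rewrite -[x]add0r PQE// rpred0.
by move=> x y /PE xE /QE yE; rewrite rpredD.
Qed.

Fact shriek_openT U V : shriek_open (@subT k (tensor U V)).
Proof. by exists (opensubT U), (opensubT V). Qed.

Fact shriek_openI U V (E F : submodClosed (tensor U V)) :
  shriek_open E -> shriek_open F -> shriek_open (subI E F).
Proof.
move=> /shriek_openP[P [Q [PE QE]]] /shriek_openP[P' [Q' [PF QF]]].
apply/shriek_openP; exists (opensubI P P'), (opensubI Q Q').
split; apply/tensor_subP => p q.
  move=> /andP[pP pP'] qT; apply/andP; split.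
    by move/tensor_subP: PE; apply.
  by move/tensor_subP: PF; apply.
move=> pT /andP[qQ qQ']; apply/andP; split.
  by move/tensor_subP: QE; apply.
by move/tensor_subP: QF; apply.
Qed.

Fact shriek_openS U V (E F : submodClosed (tensor U V)) :
  {subset E <= F} -> shriek_open E -> shriek_open F.
Proof.
by move=> EF [P [Q PQE]]; exists P, Q => x y xP yQ; apply/EF/PQE.
Qed.

Fact shriek_open_pre U V U' V' (f : hom U U') (g : hom V V') E :
  shriek_open E -> shriek_open (presub (tensor_map f g) E).
Proof.
move=> /shriek_openP[P [Q [PE QE]]]; apply/shriek_openP.
exists (opensub_pre f P), (opensub_pre g Q); split; apply/tensor_subP => p q.
  by move=> pP _; rewrite presub_tprod; move/tensor_subP: PE; apply.
by move=> _ qQ; rewrite presub_tprod; move/tensor_subP: QE; apply.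
Qed.

Definition shriek_topology := TensorTopology
  shriek_openT shriek_openI shriek_openS shriek_open_pre.

End ThreeTopologies.

Section Category.
Context {k : fieldType}.
Implicit Types A B C D : topSCType k.

Definition is_kernel A B C (i : hom A B) (p : hom B C) :=
  hom_comp p i = hom_zero A C /\
  forall D (g : hom D B), hom_comp p g = hom_zero D C ->
    exists! h : hom D A, hom_comp i h = g.

Definition is_cokernel A B C (p : hom B C) (i : hom A B) :=
  hom_comp p i = hom_zero A C /\
  forall D (g : hom B D), hom_comp g i = hom_zero A D ->
    exists! h : hom C D, hom_comp h p = g.

Definition Ex1 A B C (i : hom A B) (p : hom B C) :=
  is_kernel i p /\ is_cokernel p i.

End Category.

Record endofunctor (k : fieldType) := Endofunctor {
  fob :> topSCType k -> topSCType k;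
  fmor : forall A B : topSCType k, hom A B -> hom (fob A) (fob B);
  fmor_id : forall A : topSCType k, fmor (hom_id A) = hom_id (fob A);
  fmor_comp : forall (A B C : topSCType k) (g : hom B C) (f : hom A B),
    fmor (hom_comp g f) = hom_comp (fmor g) (fmor f)
}.

Record bifunctor (k : fieldType) := Bifunctor {
  bob :> topSCType k -> topSCType k -> topSCType k;
  bmor : forall A B A' B' : topSCType k, hom A A' -> hom B B' ->
    hom (bob A B) (bob A' B');
  bmor_id : forall A B : topSCType k,
    bmor (hom_id A) (hom_id B) = hom_id (bob A B);
  bmor_comp : forall (A B A' B' A'' B'' : topSCType k)
    (f' : hom A' A'') (f : hom A A') (g' : hom B' B'') (g : hom B B'),
    bmor (hom_comp f' f) (hom_comp g' g) = hom_comp (bmor f' g') (bmor f g)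
}.

Section Functors.
Context {k : fieldType}.

Definition preserves_cokernels (F : endofunctor k) :=
  forall (A B C : topSCType k) (f : hom A B) (c : hom B C),
    is_cokernel c f -> is_cokernel (fmor F c) (fmor F f).

Definition preserves_Ex1 (F : endofunctor k) :=
  forall (A B C : topSCType k) (i : hom A B) (p : hom B C),
    Ex1 i p -> Ex1 (fmor F i) (fmor F p).

Section Partial.
Context (F : bifunctor k) (X : topSCType k).

Fact fix_left_comp (A B C : topSCType k) (g : hom B C) (f : hom A B) :
  bmor F (hom_id X) (hom_comp g f) =
  hom_comp (bmor F (hom_id X) g) (bmor F (hom_id X) f).
Proof. by rewrite -bmor_comp; congr bmor; exact: hom_ext. Qed.
Definition fix_left : endofunctor k :=
  @Endofunctor k (F X) (fun A B => bmor F (hom_id X))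
    (fun A => bmor_id F X A) fix_left_comp.

Fact fix_right_comp (A B C : topSCType k) (g : hom B C) (f : hom A B) :
  bmor F (hom_comp g f) (hom_id X) =
  hom_comp (bmor F g (hom_id X)) (bmor F f (hom_id X)).
Proof. by rewrite -bmor_comp; congr bmor; exact: hom_ext. Qed.
Definition fix_right : endofunctor k :=
  @Endofunctor k (F^~ X) (fun A B f => bmor F f (hom_id X))
    (fun A => bmor_id F A X) fix_right_comp.

End Partial.

Section CompletedTensor.
Context (T : tensor_topology k).

Fact completed_tensor_id (A B : topSCType k) :
  completion_map (ttensor_map T (hom_id A) (hom_id B)) =
  hom_id (completion (ttensor T A B)).
Proof. by rewrite ttensor_map_id completion_map_id. Qed.

Fact completed_tensor_comp (A B A' B' A'' B'' : topSCType k)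
    (f' : hom A' A'') (f : hom A A') (g' : hom B' B'') (g : hom B B') :
  completion_map (ttensor_map T (hom_comp f' f) (hom_comp g' g)) =
  hom_comp (completion_map (ttensor_map T f' g'))
    (completion_map (ttensor_map T f g)).
Proof. by rewrite ttensor_map_comp completion_map_comp. Qed.

Definition completed_tensor : bifunctor k :=
  @Bifunctor k (fun A B => completion (ttensor T A B))
    (fun A B A' B' f g => completion_map (ttensor_map T f g))
    completed_tensor_id completed_tensor_comp.

End CompletedTensor.

End Functors.

Definition completed_star (k : fieldType) := completed_tensor (@star_topology k).
Definition completed_left (k : fieldType) := completed_tensor (@left_topology k).
Definition completed_shriek (k : fieldType) :=
  completed_tensor (@shriek_topology k).

(* Main.v *)
From HB Require Import structures.
From mathcomp Require Import all_boot all_algebra.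
From mathcomp Require Import boolp classical_sets functions filter topology.
Require Import Defs.

(** The cokernel of [f : A -> B] in complete separated spaces is the completion
of [B / f A], and a morphism [c : B -> C] is of this kind exactly when
[c \o f = 0], the image of [c] is dense, and every open subspace of [B]
containing [f A] also contains the preimage of an open subspace of [C]
([dense_quotient]). Likewise a kernel is a topological embedding, and
conversely, a dense quotient [i], [p] in which [i] is an embedding satisfies
Ex1: an element killed by [p] is a limit of elements of [i A], and [A] is
complete ([embedding_kernel]). Both notions make sense without completeness and
pass to completions, so everything is reduced to the uncompleted tensor product:
tensoring by [X] has to preserve dense quotients and embeddings.

For both notions, and for [g : B -> C] being the quotient or the embedding, the
question is the following: given an open subspace [E] of [X \otimes B], find an
open subspace [E'] of [X \otimes C] whose preimage is contained in [E]. The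
bilinear map [beta : X * B -> (X \otimes B) / E] is extended to a bilinear map
[h] on [X * C], and [E'] is the kernel of the linear map induced by [h]. Then
the preimage of [E'] is [E], whatever the topology, and only the openness of
[E'] depends on [h].

If [g] is a dense quotient of [f] and [E] contains [X \otimes f A], then [h x] is
the extension by continuity of [beta x], which vanishes on an open subspace
containing [f A] ([dense_quotient_bilinear_extension]). If [g] is an embedding,
each [beta x] extends to [C], and the extensions can be chosen linearly in [x],
by Zorn's lemma. The star topology demands more: if [beta] vanishes on [P * Q],
with [P] and [Q] open, then [h] has to vanish on [P * W] for some open [W] in
[C]. Hence [h] is prescribed on [P] as [beta p (r z)], where [r : C -> B] is a
linear map which is a retraction of [g] modulo [Q] and sends [W] to [Q], and the
choice is made so as to extend this prescription
([embedding_bilinear_extension]).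

The openness of [E] in each of the three topologies only depends on the relation
[x \otimes b \in E], and it carries over to [E'] by the same three properties of
[h], listed in [bilinear_extension] ([extendable]). *)

Set Implicit Arguments.
Unset Strict Implicit.
Unset Printing Implicit Defensive.

Import GRing.Theory.
Local Open Scope classical_set_scope.
Local Open Scope ring_scope.
Local Open Scope quotient_scope.

(** * Linear algebra *)

Section LinearAlgebra.
Context {k : fieldType}.
Implicit Types V W X Y D : lmodType k.

Definition mklinear V W (f : V -> W) (fl : linear f) : {linear V -> W} :=
  HB.pack f (GRing.isLinear.Build k V W *:%R f fl).

Definition subspace V (A : set V) :=
  A 0 /\ forall a x y, A x -> A y -> A (a *: x + y).

Fact mksubspace_proof V (A : set V) : subspace A ->
  submod_closed [pred x | `[< A x >]].
Proof.
move=> [A0 AP]; split=> [|a x y]; first by apply/asboolP; exact: A0.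
by move=> /asboolP Ax /asboolP Ay; apply/asboolP; exact: AP.
Qed.
Definition mksubspace V (A : set V) (sA : subspace A) : submodClosed V :=
  mksub (mksubspace_proof sA).

Lemma mksubspaceP V (A : set V) (sA : subspace A) x :
  x \in mksubspace sA <-> A x.
Proof. by split=> [/asboolP // | Ax]; apply/asboolP. Qed.

Lemma memN V (W : submodClosed V) x : (- x \in W) = (x \in W).
Proof. exact: (@rpredN V (sub_zmod W)). Qed.

Lemma memBC V (W : submodClosed V) x y : (x - y \in W) = (y - x \in W).
Proof. by rewrite -opprB memN. Qed.

Lemma memB V (W : submodClosed V) x y : x \in W -> y \in W -> x - y \in W.
Proof. exact: subspaceB. Qed.

Lemma memB_trans V (W : submodClosed V) y x z :
  x - y \in W -> y - z \in W -> x - z \in W.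
Proof. by move=> xy yz; rewrite -(subrKA y) rpredD. Qed.

(** By Zorn's lemma: [M] is maximal among the subspaces containing [W] whose
intersection with [S] is no larger than that of [W]. *)
Lemma exists_relative_complement V (S W : submodClosed V) :
  exists M : submodClosed V, [/\ {subset W <= M},
    forall x, x \in M -> x \in S -> x \in W &
    forall v, exists2 s, s \in S & v - s \in M].
Proof.
pose good (A : set V) := subspace A /\ forall x, A x -> x \in S -> x \in W.
(* The subspace [W] is added by hand because the union of the empty chain is
   empty. *)
have [|A [[sA AS] Amax]] := @Zorn_bigcup V [set A | good ([set` W] `|` A)].
  move=> F FP Ftot; split; last first.
    move=> x [//|[A /FP[_ AS] Ax] xS]; apply: AS => //; by right.
  split=> [|a x y]; first by left; apply: rpred0.
  move=> [xW|[A FA Ax]] [yW|[B FB By]].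
  - by left; rewrite /= rpredD ?rpredZ.
  - have [[_ BP] _] := FP _ FB.
    by case: (BP a x y) => [||?|?]; [left|right|left|right; exists B].
  - have [[_ AP] _] := FP _ FA.
    by case: (AP a x y) => [||?|?]; [right|left|left|right; exists A].
  - have [C [FC Cx Cy]] : exists C, [/\ F C, C x & C y].
      have [AB|BA] := Ftot _ _ FA FB; [exists B | exists A]; split=> //.
        exact: AB.
      exact: BA.
    have [[_ CP] _] := FP _ FC.
    by case: (CP a x y) => [||?|?]; [right|right|left|right; exists C].
exists (mksubspace sA); split.
- by move=> x xW; apply/mksubspaceP; left.
- by move=> x /mksubspaceP; exact: AS.
(* If [v] is not in [M + S], then adding the line of [v] to [M] does not enlarge
   the intersection with [S], which contradicts maximality. *)
move=> v; apply: contrapT => nv.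
pose B := [set x | exists a : k, ([set` W] `|` A) (x - a *: v)].
have AB x : ([set` W] `|` A) x -> B x.
  by move=> Ax; exists 0; rewrite scale0r subr0.
have vS a x : ([set` W] `|` A) (x - a *: v) -> x \in S -> a = 0.
  move=> xa xS; apply/eqP/negP => /negP a0; apply: nv.
  exists (a^-1 *: x); first exact: rpredZ.
  have -> : v - a^-1 *: x = (- a^-1) *: (x - a *: v).
    by rewrite scalerBr !scaleNr scalerA mulVf// scale1r opprK addrC.
  by rewrite rpredZ//; apply/mksubspaceP.
apply: (Amax B).
  split=> [x Ax|BA]; first by apply: AB; right.
  apply: nv; exists 0; first exact: rpred0.
  rewrite subr0; apply/mksubspaceP; right; apply: BA.
  by exists 1; rewrite scale1r subrr; left; exact: rpred0.
have WB : [set` W] `|` B = B.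
  by apply/seteqP; split=> x; [move=> []// xW; apply: AB; left | right].
rewrite /= WB; split; last first.
  move=> x [a xa] xS; have a0 := vS _ _ xa xS.
  by move: xa; rewrite a0 scale0r subr0 => /AS; apply.
split=> [|c x y [a xa] [b yb]]; first by apply: AB; left; exact: rpred0.
exists (c * a + b).
rewrite scalerDl -scalerA opprD addrACA -scalerBr.
by have [_ AP] := sA; apply: AP.
Qed.

(** A total linear relation [G] contains the graph of a linear map, which may be
prescribed on a subspace. The graph is cut out of [G] by a complement [M] of
[G] meeting [0 * Y]: it meets each fiber of [G] in one point. Taking for [M] a
complement that contains the prescribed part of the graph fixes the values
there. *)
Lemma linear_choice X Y (G : set (X * Y)) (P : submodClosed X) (s0 : X -> Y) :
    subspace G -> (forall x, exists y, G (x, y)) ->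
    linear s0 -> (forall x, x \in P -> G (x, s0 x)) ->
  exists s : X -> Y, [/\ linear s, forall x, G (x, s x) &
    forall x, x \in P -> s x = s0 x].
Proof.
move=> [G0 GP] Gtot s0l s0G.
have s00 : s0 0 = 0.
  by have := s0l (-1) 0 0; rewrite scaler0 addr0 scaleN1r addNr.
have sN : subspace [set z : X * Y | z.1 = 0 /\ G z].
  split=> // a x y [x0 Gx] [y0 Gy]; split; last exact: GP.
  by rewrite /= x0 y0 scaler0 addr0.
have sP : subspace [set z : X * Y | z.1 \in P /\ z.2 = s0 z.1].
  split=> /=; first by rewrite rpred0 s00.
  move=> a x y [xP ->] [yP ->]; split; first by rewrite rpredD ?rpredZ.
  by rewrite s0l.
have [M [PM MN MT]] := exists_relative_complement (mksubspace sN) (mksubspace sP).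
have MG0 y : (0, y) \in M -> G (0, y) -> y = 0.
  move=> yM yG; have /mksubspaceP[_ /=] : (0, y) \in mksubspace sP.
    by apply: MN => //; apply/mksubspaceP.
  by rewrite s00.
have MGex x : exists y, (x, y) \in M /\ G (x, y).
  have [y Gxy] := Gtot x.
  have [[n1 n2] /mksubspaceP[/= n10 Gn]] := MT (x, y).
  have -> : (x, y) - (n1, n2) = (x, y - n2).
    by rewrite n10; congr (_, _); rewrite subr0.
  move=> xM; exists (y - n2); split=> //.
  have <- : (-1) *: (n1, n2) + (x, y) = (x, y - n2).
    by rewrite scaleN1r addrC n10; congr (_, _); exact: subr0.
  exact: GP.
have MGuniq x y y' : (x, y) \in M /\ G (x, y) -> (x, y') \in M /\ G (x, y') ->
    y = y'.
  move=> [yM Gy] [y'M Gy']; apply/eqP; rewrite -subr_eq0; apply/eqP.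
  have E : (-1) *: (x, y') + (x, y) = (0, y - y').
    by rewrite scaleN1r addrC; congr (_, _); exact: subrr.
  apply: MG0; rewrite -E; first exact: rpredD (rpredZ _ y'M) yM.
  exact: GP.
have [s sP'] := choice MGex; exists s; split.
- move=> a x y; apply: MGuniq; first exact: sP'.
  have [xM xG] := sP' x; have [yM yG] := sP' y.
  by split; [exact: (rpredD (rpredZ a xM) yM) | exact: (GP _ _ _ xG yG)].
- by move=> x; have [] := sP' x.
- move=> x xP; apply: MGuniq; first exact: sP'.
  split; last exact: s0G.
  by apply: PM; apply/mksubspaceP.
Qed.

(** An exact retraction of [i] mapping [Y] to [Q] need not exist, [i] being
arbitrary. Modulo [Q] it does: [r w] is an element whose image is congruent to
[w] modulo a subspace [M] containing [Y] that spans [W] together with the image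
of [i] and meets this image only in [Y]. *)
Lemma approximate_retraction V W (i : {linear V -> W})
    (Q : submodClosed V) (Y : submodClosed W) :
    (forall v, i v \in Y -> v \in Q) ->
  exists r : W -> V, [/\ linear r, forall v, r (i v) - v \in Q &
    forall y, y \in Y -> r y \in Q].
Proof.
move=> iYQ.
have sS : subspace [set w | exists v, i v = w].
  split; first by exists 0; rewrite linear0.
  by move=> a _ _ [v <-] [v' <-]; exists (a *: v + v'); rewrite linearP.
have [M [YM MS MT]] := exists_relative_complement (mksubspace sS) Y.
have MQ v : i v \in M -> v \in Q.
  by move=> vM; apply/iYQ/MS => //; apply/mksubspaceP; exists v.
pose G := [set z : W * V | z.1 - i z.2 \in M].
have [|||w|r [rl rM _]] := @linear_choice W V G sub0 (fun=> 0).
- split=> [|a x y xM yM]; first by rewrite /G /= linear0 subr0 rpred0.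
  by rewrite /G /= linearP opprD addrACA -scalerBr rpredD ?rpredZ.
- move=> w; have [_ /mksubspaceP[v <-] wM] := MT w; by exists v.
- by move=> a x y; rewrite scaler0 addr0.
- by rewrite inE => /eqP ->; rewrite /G /= linear0 subr0 rpred0.
exists r; split=> // [v|y yY].
  apply: MQ; rewrite linearB memBC; exact: rM.
apply: MQ; have := memB (YM _ yY) (rM y); by rewrite /= subKr.
Qed.

End LinearAlgebra.

(** * Dense quotients and embeddings *)

Section Strict.
Context {k : fieldType}.
Implicit Types A B C D V : linTopType k.

Lemma homP V C (f : hom V C) a x y : f (a *: x + y) = a *: f x + f y.
Proof. exact: linearP. Qed.

Lemma homB V C (f : hom V C) x y : f (x - y) = f x - f y.
Proof. exact: linearB. Qed.

Lemma mkhom_continuous V C (f : V -> C) (fl : linear f) :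
    (forall Y : opensub C, exists W : opensub V, forall x, x \in W -> f x \in Y) ->
  continuous (mklinear fl).
Proof.
move=> fc; apply/linear_continuousP => Y oY; apply/open_subspaceP.
by have [W WY] := fc (OpenSub oY); exists W; first exact: opensub_open.
Qed.

Lemma hom_open V C (f : hom V C) (Y : opensub C) :
  exists W : opensub V, forall x, x \in W -> f x \in Y.
Proof. by exists (opensub_pre f Y). Qed.

Lemma near_image V C (f : hom V C) (Y : opensub C) :
  exists S : opensub C, forall z, z \in S <-> exists v, f v - z \in Y.
Proof.
have sS : subspace [set z | exists v, f v - z \in Y].
  split; first by exists 0; rewrite linear0 subr0 rpred0.
  move=> a x y [v vx] [v' v'y]; exists (a *: v + v').
  by rewrite homP opprD addrACA -scalerBr rpredD ?rpredZ.
have oS : open [set` mksubspace sS].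
  apply/open_subspaceP; exists Y; first exact: opensub_open.
  by move=> x xY; apply/mksubspaceP; exists 0; rewrite linear0 sub0r memN.
by exists (OpenSub oS) => z; exact: mksubspaceP.
Qed.

Lemma opensub_to_completion V (Y : opensub (completion V)) :
  exists U : opensub V, forall x, pr x U = 0 -> x \in Y.
Proof.
have /open_completionP[U UY] := opensub_open Y; exists U => x x0.
exact/UY/kerprP.
Qed.

Fact to_completion_continuous V :
  continuous (@to_completion k V : {linear V -> completion V}).
Proof.
apply/linear_continuousP => Y oY; apply/open_subspaceP.
have [U UY] := opensub_to_completion (OpenSub oY).
exists U; first exact: opensub_open.
by move=> x xU; apply: UY; apply/lquot_eq0.
Qed.
Definition to_completion_hom V : hom V (completion V) :=
  Hom (@to_completion_continuous V).

Lemma separated_eq0 (V : topSCType k) (x : V) :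
  (forall U : opensub V, x \in U) -> x = 0.
Proof.
move=> xU; apply: to_completion_inj; apply: completion_ext => U.
by rewrite linear0; apply/lquot_eq0.
Qed.

Lemma separated_eq (V : topSCType k) (x y : V) :
  (forall U : opensub V, x - y \in U) -> x = y.
Proof. by move=> /separated_eq0/eqP; rewrite subr_eq0 => /eqP. Qed.

(** [F U] is the set of approximations at precision [U] of the limit to be
found. The first hypothesis makes these sets a Cauchy filter base up to
refinement, the [F U] not being assumed to decrease with [U]. *)
Lemma complete_limit (V : topSCType k) (F : opensub V -> V -> Prop) :
    (forall U U', exists2 v, F U v & F U' v) ->
    (forall U v v', F U v -> F U v' -> v - v' \in U) ->
  exists y, forall U v, F U v -> v - y \in U.
Proof.
move=> Fex Fsmall.
have /choice[r rF] : forall U, exists v, F U v.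
  by move=> U; have [v] := Fex U U; exists v.
have rc (U W : opensub V) : {subset U <= W} ->
    \pi_(lquot W) (repr (\pi_(lquot U) (r U))) = \pi_(lquot W) (r W).
  move=> UW; rewrite lquot_transE//; apply/lquotP.
  have [v vU vW] := Fex U W.
  apply: (memB_trans (y := v)); last exact: Fsmall (rF W).
  by apply/UW/(Fsmall U).
have [y yE] := to_completion_surj (Completion rc).
exists y => U v vU.
have /lquotP/= := congr1 (fun z => pr z U) yE => yr.
by apply: (memB_trans (Fsmall _ _ _ vU (rF U))); rewrite memBC.
Qed.

(** This says that the completion of [c] identifies the completion of [C] with
that of the quotient of [B] by the image of [f]. *)
Definition dense_quotient A B C (f : hom A B) (c : hom B C) := [/\
  forall a, c (f a) = 0,
  forall (W : opensub C) z, exists b, c b - z \in W &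
  forall U : opensub B, (forall a, f a \in U) ->
    exists W : opensub C, forall b, c b \in W -> b \in U].

Definition embedding A B (i : hom A B) :=
  forall U : opensub A, exists W : opensub B, forall a, i a \in W -> a \in U.

(** The value of the factorization at [z] is the limit of [g b] as [c b] tends to
[z]. *)
Lemma dense_quotient_universal A B C (D : topSCType k)
    (f : hom A B) (c : hom B C) (g : hom B D) :
    dense_quotient f c -> hom_comp g f = hom_zero A D ->
  exists! h : hom C D, hom_comp h c = g.
Proof.
move=> [cf dc qc] gf.
have gf0 a : g (f a) = 0 by have := congr1 (fun h : hom _ _ => h a) gf.
have adapted (Y : opensub D) : exists W : opensub C,
    forall b, c b \in W -> g b \in Y.
  by apply: (qc (opensub_pre g Y)) => a; rewrite presubE /= gf0 rpred0.
(* The limit is characterized for every [W] adapted to [Y], not only for the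
   chosen one, so that linearity may compare limits with the same [W]. *)
have hex z : exists y, forall (Y : opensub D) (W : opensub C),
    (forall b, c b \in W -> g b \in Y) ->
    forall b, c b - z \in W -> g b - y \in Y.
  have /choice[w wP] := adapted.
  have close (Y : opensub D) (W : opensub C) b b' :
      (forall b, c b \in W -> g b \in Y) ->
      c b - z \in W -> c b' - z \in W -> g b - g b' \in Y.
    move=> WY bW b'W; rewrite -homB; apply: WY.
    by rewrite homB; apply: (memB_trans bW); rewrite memBC.
  have [] := @complete_limit D (fun Y d => exists2 b, d = g b & c b - z \in w Y).
  - move=> Y Y'; have [b /andP[bW bW']] := dc (opensubI (w Y) (w Y')) z.
    by exists (g b); exists b.
  - by move=> Y _ _ [b -> bW] [b' -> b'W]; apply: close (wP Y) bW b'W.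
  - move=> y yP; exists y => Y W WY b bW.
    have [b' /andP[b'W b'w]] := dc (opensubI W (w Y)) z.
    apply: (memB_trans (close _ _ _ _ WY bW b'W)).
    by apply: yP; exists b'.
have [h hP] := choice hex.
have hl : linear h.
  move=> a x y; apply: separated_eq => Y; have [W WY] := adapted Y.
  have [b bW] := dc W x; have [b' b'W] := dc W y.
  have bb' : c (a *: b + b') - (a *: x + y) \in W.
    by rewrite homP opprD addrACA -scalerBr rpredD ?rpredZ.
  have := hP _ Y W WY _ bb'; rewrite memBC => /memB_trans; apply.
  rewrite homP opprD addrACA -scalerBr rpredD ?rpredZ//.
    exact: (hP _ _ _ WY _ bW).
  exact: (hP _ _ _ WY _ b'W).
have hc : continuous (mklinear hl).
  apply: mkhom_continuous => Y; have [W WY] := adapted Y; exists W => z zW.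
  by have := hP z Y W WY 0; rewrite !linear0 !sub0r !memN; apply.
exists (Hom hc); split.
  apply: hom_ext => b; apply: separated_eq => Y; have [W WY] := adapted Y.
  rewrite memBC; apply: (hP _ _ _ WY); by rewrite subrr rpred0.
move=> h' h'c; apply: hom_ext => z; apply: separated_eq => Y.
have [W WY] := adapted Y; have [b] := dc (opensubI W (opensub_pre h' Y)) z.
move=> /andP[bW]; rewrite presubE homB.
have -> : h' (c b) = g b by rewrite -h'c.
move=> bY; apply: memB_trans bY; rewrite memBC; exact: (hP _ _ _ WY _ bW).
Qed.

End Strict.

(** * Cokernels and kernels of complete separated spaces *)

Section Retopologize.
Context {k : fieldType} (V : lmodType k) (base : submodClosed V -> Prop).
Hypothesis base_ex : exists U, base U.
Hypothesis baseI : forall U W, base U -> base W ->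
  exists2 X, base X & {subset X <= U} /\ {subset X <= W}.

(** The base and its properties are phantom arguments: they make the topology of
[retop] canonical although its carrier is [V]. *)
Definition retop of (exists U, base U) & (forall U W, base U -> base W ->
  exists2 X, base X & {subset X <= U} /\ {subset X <= W}) : Type := V.

HB.instance Definition _ := GRing.Lmodule.on (retop base_ex baseI).
HB.instance Definition _ :=
  hasOpenSubspaceBase.Build k (retop base_ex baseI) base_ex baseI.

Lemma open_retopP (W : submodClosed (retop base_ex baseI)) :
  open [set` W] <-> exists2 U, base U & {subset U <= W}.
Proof.
split=> [oW|[U bU UW]].
  have : nbhs (0 : retop base_ex baseI) [set` W].
    by apply: open_nbhs_nbhs; split=> //=; exact: rpred0.
  by move=> [U bU UW]; exists U => // x xU; apply: UW; rewrite subr0.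
rewrite openE => x /= xW; exists U => // y /UW yW /=.
by rewrite -(subrK x y) rpredD.
Qed.

Lemma retop_open U : base U -> @open (retop base_ex baseI) [set` U].
Proof. by move=> bU; apply/open_retopP; exists U. Qed.

End Retopologize.

Section TestObjects.
Context {k : fieldType}.

(** The coarsest linear topology in which [U] is open; its completion is the
discrete space [V / U]. *)
Section Coarse.
Context {V : lmodType k} (U : submodClosed V).
Fact coarse_ex : exists W : submodClosed V, W = U. Proof. by exists U. Qed.
Fact coarseI (W X : submodClosed V) : W = U -> X = U ->
  exists2 Y, Y = U & {subset Y <= W} /\ {subset Y <= X}.
Proof. by move=> -> ->; exists U => //; split. Qed.
Definition coarse : linTopType k := retop coarse_ex coarseI.
End Coarse.

Section Induced.
Context {V W : linTopType k} (i : hom V W).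
Let base (U : submodClosed V) := exists Y : opensub W, U = presub i Y.
Fact induced_ex : exists U, base U.
Proof. by exists (presub i (opensubT W)), (opensubT W). Qed.
Fact inducedI U X : base U -> base X ->
  exists2 Y, base Y & {subset Y <= U} /\ {subset Y <= X}.
Proof.
move=> [Y ->] [Z ->]; exists (presub i (opensubI Y Z)).
  by exists (opensubI Y Z).
by split=> x; rewrite !presubE => /andP[].
Qed.
Definition induced : linTopType k := retop induced_ex inducedI.
End Induced.

Implicit Types A B C : topSCType k.

Lemma to_coarse (V : linTopType k) (U : opensub V) :
  exists2 g : hom V (completion (coarse U)),
    (forall v, (forall W : submodClosed V, {subset U <= W} -> v \in W) -> g v = 0) &
    exists Y : opensub (completion (coarse U)), forall v, g v \in Y -> v \in U.
Proof.
have idc : continuous (@idfun V : {linear V -> coarse U}).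
  apply/linear_continuousP => W /open_retopP[_ -> UW]; apply/open_subspaceP.
  by exists U => //; exact: opensub_open.
exists (hom_comp (to_completion_hom (coarse U)) (Hom idc)).
  move=> v vW; apply: completion_ext => W; apply/lquot_eq0; apply: vW.
  by have /open_retopP[_ ->] := opensub_open W.
have oU : @open (coarse U) [set` U] by exact: retop_open.
exists (opensub_kerpr (OpenSub oU)) => v /kerprP vU.
exact/lquot_eq0.
Qed.

(** The two topological conditions are tested on maps to discrete spaces. *)
Lemma cokernel_dense_quotient A B C (f : hom A B) (c : hom B C) :
  is_cokernel c f -> dense_quotient f c.
Proof.
move=> [cf cU].
have cf0 a : c (f a) = 0 by have := congr1 (fun h : hom _ _ => h a) cf.
split=> //.
- move=> W z.
  (* The quotient of [C] by [c B + W] receives a map from [C] which, like zero,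
     composes with [c] to zero. *)
  have [S SE] := near_image c W.
  have [g g0 [Y YS]] := to_coarse S.
  have gc b : g (c b) = 0.
    apply: g0 => X; apply; apply/SE; exists b.
    by rewrite subrr rpred0.
  have [|h [_ hu]] := cU _ (hom_zero B (completion (coarse S))).
    exact: hom_ext.
  have gE : g = hom_zero C _.
    rewrite -(hu g); last by apply: hom_ext => b; exact: gc.
    by apply: hu; apply: hom_ext.
  by apply/SE/(YS z); rewrite gE; exact: rpred0.
- (* The projection to [B / U] factors through [c]. *)
  move=> U fU; have [g g0 [Y YU]] := to_coarse U.
  have [|h [hc _]] := cU _ g.
    by apply: hom_ext => a; apply: g0 => W; apply; exact: fU.
  have [W WY] := hom_open h Y; exists W => b /WY hb; apply: YU.
  by rewrite -hc.
Qed.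

Lemma dense_quotient_cokernel A B C (f : hom A B) (c : hom B C) :
  dense_quotient f c -> is_cokernel c f.
Proof.
move=> fc; split; first by have [cf _ _] := fc; apply: hom_ext.
by move=> D g; exact: dense_quotient_universal.
Qed.

(** Through this, [dense_quotient_universal] also gives the extension of
morphisms to the completion. *)
Lemma to_completion_dense_quotient (V : linTopType k) :
  dense_quotient (hom_zero V V) (to_completion_hom V).
Proof.
split=> [a|Y z|U _]; first exact: linear0.
  have [U UY] := opensub_to_completion Y; exists (repr (pr z U)).
  by apply: UY; rewrite prB /= reprK subrr.
by exists (opensub_kerpr U) => b /kerprP /lquot_eq0.
Qed.

(** The test object is the completion of [A] for the topology induced by [i].
The extension of [i] to it is killed by [p], hence factors through [i]; the
factorization, restricted to [A], is the identity by the uniqueness in the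
universal property of the kernel. Thus the identity is continuous from the
induced topology to that of [A]. *)
Lemma kernel_embedding A B C (i : hom A B) (p : hom B C) :
  is_kernel i p -> embedding i.
Proof.
move=> [pi iU] U.
have pi0 a : p (i a) = 0 by have := congr1 (fun h : hom _ _ => h a) pi.
have jc : continuous (@idfun A : {linear A -> induced i}).
  by apply/linear_continuousP => W /open_retopP[_ [Y ->] YW];
    apply/open_subspaceP; exists (opensub_pre i Y) => //; exact: opensub_open.
have ic : continuous (i : {linear induced i -> B}).
  apply/linear_continuousP => Y oY; apply: retop_open.
  by exists (OpenSub oY).
have tcq := to_completion_dense_quotient (induced i).
have [|g [gE _]] := dense_quotient_universal (g := Hom ic) tcq.
  by apply: hom_ext => a; exact: linear0.
have gE' a : g (to_completion_hom (induced i) a) = i a.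
  exact: (congr1 (fun f : hom (induced i) B => f a) gE).
have [|h [hE _]] := iU _ g.
  have [|z [_ zu]] := dense_quotient_universal
    (g := hom_zero (induced i) C) tcq; first exact: hom_ext.
  rewrite -(zu (hom_comp p g)) ?(zu (hom_zero _ C))//; first exact: hom_ext.
  by apply: hom_ext => a; rewrite -[RHS](pi0 a) -gE'.
have [r [_ ru]] := iU _ i pi.
pose h' := hom_comp h (to_completion_hom (induced i)).
have h'E (a : A) : h' (a : induced i) = a.
  have -> : h' (a : induced i) = hom_comp h' (Hom jc) a by [].
  rewrite -(ru (hom_comp h' (Hom jc))).
    by rewrite (ru (hom_id A)); last exact: hom_ext.
  apply: hom_ext => b.
  have -> : hom_comp i (hom_comp h' (Hom jc)) b =
    hom_comp (hom_comp i h) (to_completion_hom (induced i)) b by [].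
  by rewrite hE; exact: gE'.
have [X XU] := hom_open h' U.
have /open_retopP[_ [Y ->] YX] := opensub_open X.
exists Y => a aY; rewrite -(h'E a); apply: XU; exact: YX.
Qed.

(** If [p b = 0], then [b] belongs to every open subspace containing the image of
[i], so that it is a limit of elements [i a]; as [i] is an embedding, these [a]
form a Cauchy family and converge in [A]. *)
Lemma embedding_kernel A B C (i : hom A B) (p : hom B C) :
  dense_quotient i p -> embedding i -> is_kernel i p.
Proof.
move=> [pi _ qp] ei; split; first exact: hom_ext.
have i_inj a a' : i a = i a' -> a = a'.
  move=> ia; apply: separated_eq => U; have [W WU] := ei U.
  by apply: WU; rewrite homB ia subrr rpred0.
have ker b : p b = 0 -> exists a, i a = b.
  move=> pb; have [w wP] := choice ei.
  have close (Y : opensub B) : exists a, i a - b \in Y.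
    have [S SE] := near_image i Y.
    have [|W WS] := qp S.
      by move=> a; apply/SE; exists a; rewrite subrr rpred0.
    by apply/SE/(WS b); rewrite pb rpred0.
  have small U a a' : i a - b \in w U -> i a' - b \in w U -> a - a' \in U.
    move=> aU a'U; apply: wP; rewrite homB.
    by apply: (memB_trans aU); rewrite memBC.
  have [U U'||a aP] := @complete_limit _ A (fun U a => i a - b \in w U).
  - by have [a /andP[]] := close (opensubI (w U) (w U')); exists a.
  - exact: small.
  exists a; apply: separated_eq => Y.
  have [a' /andP[a'w a'Y]] := close (opensubI (w (opensub_pre i Y)) Y).
  apply: memB_trans a'Y; rewrite memBC -homB.
  exact: (aP (opensub_pre i Y)).
move=> D g pg.
have /choice[h hP] : forall d, exists a, i a = g d.
  move=> d; apply: ker.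
  exact: (congr1 (fun f : hom _ _ => f d) pg).
have hl : linear h by move=> a x y; apply: i_inj; rewrite homP !hP homP.
have hc : continuous (mklinear hl).
  apply: mkhom_continuous => Y; have [W WY] := ei Y.
  have [X XW] := hom_open g W; exists X => x /XW gx; apply: WY.
  by rewrite hP.
exists (Hom hc); split; first by apply: hom_ext => d; exact: hP.
move=> h' h'g; apply: hom_ext => d; apply: i_inj; rewrite /= hP.
by rewrite -h'g.
Qed.

End TestObjects.

(** * Completion preserves dense quotients and embeddings *)

Section CompletionStrict.
Context {k : fieldType}.
Implicit Types A B C : linTopType k.

Lemma completion_map_hom A B (f : hom A B) a :
  completion_map f (to_completion_hom A a) = to_completion_hom B (f a).
Proof. exact: completion_map_to_completion. Qed.

Lemma completion_dense_quotient A B C (f : hom A B) (c : hom B C) :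
  dense_quotient f c -> dense_quotient (completion_map f) (completion_map c).
Proof.
move=> [cf dc qc]; split.
- move=> x; apply: separated_eq0 => Y.
  have [W WY] := hom_open (hom_comp (completion_map c) (completion_map f)) Y.
  have [_ /(_ W x)[a aW] _] := to_completion_dense_quotient A.
  have := WY _ aW; rewrite homB.
  have -> : hom_comp (completion_map c) (completion_map f)
      (to_completion_hom A a) = to_completion_hom C (c (f a)).
    by rewrite -!completion_map_hom.
  by rewrite cf linear0 sub0r memN.
- move=> Y z; have [_ /(_ Y z)[y yY] _] := to_completion_dense_quotient C.
  have [W WY] := hom_open (to_completion_hom C) Y.
  have [b bW] := dc W y; exists (to_completion b).
  rewrite completion_map_to_completion.
  by apply: memB_trans yY; have := WY _ bW; rewrite homB.
- move=> U fU.
  have [|W Wc] := qc (opensub_pre (to_completion_hom B) U).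
    by move=> a; rewrite presubE -completion_map_hom; exact: fU.
  exists (opensub_kerpr W) => x xW.
  have [X XW] := hom_open (completion_map c) (opensub_kerpr W).
  have [_ /(_ (opensubI U X) x)[b /andP[bU bX]] _] :=
    to_completion_dense_quotient B.
  have bW : c b \in W.
    have := rpredD (XW _ bX) xW; rewrite homB subrK.
    by rewrite completion_map_hom => /kerprP/lquot_eq0.
  have := memB (Wc _ bW : to_completion b \in U) bU.
  by rewrite subKr.
Qed.

Lemma completion_embedding A B (i : hom A B) :
  embedding i -> embedding (completion_map i).
Proof.
move=> ei Y; have [U UY] := hom_open (to_completion_hom A) Y.
have [W WU] := ei U; exists (opensub_kerpr W) => x xW.
have [X XW] := hom_open (completion_map i) (opensub_kerpr W).
have [_ /(_ (opensubI Y X) x)[a /andP[aY aX]] _] :=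
  to_completion_dense_quotient A.
have aW : i a \in W.
  have := rpredD (XW _ aX) xW; rewrite homB subrK.
  by rewrite completion_map_hom => /kerprP/lquot_eq0.
by have := memB (UY _ (WU _ aW)) aY; rewrite subKr.
Qed.

End CompletionStrict.

(** * Extension of bilinear maps *)

Section BilinearExtension.
Context {k : fieldType}.
Implicit Types A B C : linTopType k.

(** The last three conditions are what the openness of the kernel of [h] requires
in the various topologies: continuity in the second variable, joint continuity
on [P], and, for continuity in the first variable, a comparison on [P] with the
values of [beta]. *)
Definition bilinear_extension B C (g : hom B C) (X : linTopType k)
    (D : lmodType k) (beta : X -> B -> D) (P : opensub X) (h : X -> C -> D) :=
  [/\ (forall z, linear (h^~ z)) /\ (forall x, linear (h x)),
    forall x b, h x (g b) = beta x b,
    forall x, exists W : opensub C, forall w, w \in W -> h x w = 0,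
    exists W : opensub C, forall p w, p \in P -> w \in W -> h p w = 0 &
    forall z, exists b, forall p, p \in P -> h p z = beta p b].

Section Data.
Context {X B : linTopType k} {D : lmodType k} (beta : X -> B -> D).
Hypothesis beta_l : forall b, linear (beta^~ b).
Hypothesis beta_r : forall x, linear (beta x).
Hypothesis beta_cont :
  forall x, exists U : opensub B, forall b, b \in U -> beta x b = 0.
Variables (P : opensub X) (Q : opensub B).
Hypothesis beta_PQ : forall p q, p \in P -> q \in Q -> beta p q = 0.

Let betaB x b b' : beta x (b - b') = beta x b - beta x b'.
Proof. exact: (linearB (mklinear (beta_r x))). Qed.

(** The value [h x z] is that of [beta x b] for [c b] close to [z], where the
closeness [w x] depends on [x]. As [beta] vanishes on [P * (Q + f A)] and
[Q + f A] contains the preimage of some open [W], it vanishes on [p] and [b]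
when [c b] is in [W]; this passes to the limit, and each [z] is congruent modulo
[W] to some [c b]. *)
Lemma dense_quotient_bilinear_extension A C (f : hom A B) (c : hom B C) :
    dense_quotient f c -> (forall x a, beta x (f a) = 0) ->
  exists h, bilinear_extension c beta P h.
Proof.
move=> [cf dc qc] betaf.
have adapted (S : X -> Prop) (U : opensub B) :
    (forall x b, S x -> b \in U -> beta x b = 0) ->
  exists W : opensub C, forall x b, S x -> c b \in W -> beta x b = 0.
  move=> SU.
  (* This subspace contains both [U] and the image of [f]. *)
  have sK : subspace [set b | forall x, S x -> beta x b = 0].
    split=> [x _|a b b' bK b'K x Sx]; first by rewrite -(subrr 0) betaB subrr.
    by rewrite beta_r bK// b'K// scaler0 addr0.
  have oK : open [set` mksubspace sK].
    apply/open_subspaceP; exists U; first exact: opensub_open.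
    by move=> b bU; apply/mksubspaceP => x Sx; exact: SU.
  have [|W WK] := qc (OpenSub oK).
    by move=> a; apply/mksubspaceP => x _; exact: betaf.
  by exists W => x b Sx /WK /mksubspaceP; apply.
have /choice[w wP] : forall x, exists W : opensub C, forall b,
    c b \in W -> beta x b = 0.
  move=> x; have [U Ux] := beta_cont x.
  have [|W Wx] := adapted (eq x) U; first by move=> _ b <-; exact: Ux.
  by exists W => b; exact: Wx.
have close x z b b' : c b - z \in w x -> c b' - z \in w x -> beta x b = beta x b'.
  move=> bz b'z; apply/eqP; rewrite -subr_eq0 -betaB; apply/eqP/wP.
  by rewrite homB; apply: (memB_trans bz); rewrite memBC.
have /choice[h hP] : forall x, exists h : C -> D,
    forall z b, c b - z \in w x -> h z = beta x b.
  move=> x; have /choice[e eP] := dc (w x).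
  by exists (fun z => beta x (e z)) => z b bz; apply: (close x z).
have hl z : linear (h^~ z).
  move=> a x y.
  have [b /andP[/andP[bx bY] bxy]] :=
    dc (opensubI (opensubI (w x) (w y)) (w (a *: x + y))) z.
  by rewrite (hP _ _ b)// (hP x _ b)// (hP y _ b)// beta_l.
have hr x : linear (h x).
  move=> a z z'; have [b bz] := dc (w x) z; have [b' bz'] := dc (w x) z'.
  rewrite (hP _ z b)// (hP _ z' b')// -beta_r; apply: hP.
  by rewrite homP opprD addrACA -scalerBr rpredD ?rpredZ.
have hc x b : h x (c b) = beta x b by apply: hP; rewrite subrr rpred0.
have hB x z z' : h x (z - z') = h x z - h x z'.
  exact: (linearB (mklinear (hr x))).
have [W WP] := adapted [set` P] Q beta_PQ.
have hPW p y : p \in P -> y \in W -> h p y = 0.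
  move=> pP yW; have [b /andP[bW bp]] := dc (opensubI W (w p)) y.
  by rewrite (hP p y b)//; apply: WP => //; rewrite -(subrK y (c b)) rpredD.
exists h; split=> //.
- move=> x; exists (w x) => z zw; rewrite (hP _ _ 0) ?linear0 ?sub0r ?memN//.
  by rewrite -(subrr 0) betaB subrr.
- by exists W.
- move=> z; have [b bW] := dc W z; exists b => p pP.
  by have /eqP := hPW p _ pP bW; rewrite hB hc subr_eq0 => /eqP.
Qed.

(** Each [beta x] extends to [C] as [beta x \o s], with [s] a retraction of [i]
modulo a neighborhood killed by [beta x], but this neighborhood, hence [s],
depends on [x]. So [h] is chosen in the linear relation [G] between [x] and the
continuous linear extensions of [beta x]. On [P] a single retraction [r], modulo
[Q], is good for all [p], and [h] is prescribed there. *)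
Lemma embedding_bilinear_extension C (i : hom B C) :
  embedding i -> exists h, bilinear_extension i beta P h.
Proof.
move=> ei; have [W WQ] := ei Q.
have [r [rl ri rW]] := approximate_retraction WQ.
pose G := [set z : X * (C -> D) | [/\ linear z.2,
  exists U : opensub C, forall b, b \in U -> z.2 b = 0 &
  forall b, z.2 (i b) = beta z.1 b]].
have Gr x (Y : submodClosed C) (U : submodClosed B) s :
    (forall b, b \in U -> beta x b = 0) -> (forall b, s (i b) - b \in U) ->
    (forall y, y \in Y -> s y \in U) ->
    (forall y, y \in Y -> beta x (s y) = 0) /\
    (forall b, beta x (s (i b)) = beta x b).
  move=> Ux sU sY; split=> [y /sY /Ux //|b].
  by apply/eqP; rewrite -subr_eq0 -betaB; apply/eqP/Ux.
have [||||s [sl sG sP]] :=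
  @linear_choice k X (C -> D) G P (fun x b => beta x (r b)).
- split.
    split=> [a x y||b] /=; first by rewrite scaler0 addr0.
      by exists (opensubT C).
    by have := beta_l b (-1) 0 0; rewrite scaler0 addr0 scaleN1r addNr.
  move=> a [x g] [y g'] [/= gl [U gU] gi] [/= g'l [U' g'U'] g'i]; split=> /=.
  + move=> d b b'.
    change (a *: g (d *: b + b') + g' (d *: b + b') =
      d *: (a *: g b + g' b) + (a *: g b' + g' b')).
    by rewrite gl g'l !scalerDr !scalerA addrACA mulrC.
  + exists (opensubI U U') => b /andP[bU bU'].
    change (a *: g b + g' b = 0).
    by rewrite gU// g'U'// scaler0 addr0.
  + move=> b; change (a *: g (i b) + g' (i b) = beta (a *: x + y) b).
    by rewrite gi g'i beta_l.
- move=> x; have [U Ux] := beta_cont x; have [Y YU] := ei U.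
  have [s [sl sU sY]] := approximate_retraction YU.
  have [sY0 si] := Gr x Y U s Ux sU sY.
  exists (fun b => beta x (s b)); split=> //; last by exists Y.
  by move=> a b b' /=; rewrite sl beta_r.
- by move=> a x y; apply/funext => b; exact: beta_l.
- move=> p pP.
  have [rW0 ri0] := Gr p W Q r (fun q => beta_PQ pP) ri rW.
  split=> //=; last by exists W.
  by move=> a b b' /=; rewrite rl beta_r.
exists s; split.
- split=> [z a x y|x]; last by have [] := sG x.
  by rewrite sl.
- by move=> x b; have [_ _] := sG x; apply.
- by move=> x; have [] := sG x.
- exists W => p w pP wW; rewrite sP//; apply: beta_PQ => //; exact: rW.
- by move=> z; exists (r z) => p pP; rewrite sP.
Qed.

End Data.
End BilinearExtension.

(** * Openness in terms of pure tensors *)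

Section Relations.
Context {k : fieldType}.
Implicit Types X B C : linTopType k.

Definition orthogonal X B (R : X -> B -> Prop) (P : opensub X) (Q : opensub B) :=
  forall p q, p \in P -> q \in Q -> R p q.

Definition slice_open_r X B (R : X -> B -> Prop) :=
  forall x, exists Q : opensub B, forall q, q \in Q -> R x q.

Definition slice_open_l X B (R : X -> B -> Prop) :=
  forall b, exists P : opensub X, forall p, p \in P -> R p b.

Definition star_rel X B (R : X -> B -> Prop) :=
  [/\ exists P Q, orthogonal R P Q, slice_open_r R & slice_open_l R].

Definition left_rel X B (R : X -> B -> Prop) :=
  (exists P, orthogonal R P (opensubT B)) /\ slice_open_r R.

Definition right_rel X B (R : X -> B -> Prop) :=
  (exists Q, orthogonal R (opensubT X) Q) /\ slice_open_l R.

Definition shriek_rel X B (R : X -> B -> Prop) :=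
  (exists P, orthogonal R P (opensubT B)) /\
  (exists Q, orthogonal R (opensubT X) Q).

(** For [R] and [R'] the vanishing of [beta] and of [h], these are the last three
conditions of [bilinear_extension]. *)
Definition rel_extension X B C (P : opensub X) (R : X -> B -> Prop)
    (R' : X -> C -> Prop) :=
  [/\ slice_open_r R', exists W, orthogonal R' P W &
    forall z, exists b, forall p, p \in P -> R p b -> R' p z].

(** [P] and [Q] are the subspaces to which [bilinear_extension] is to be applied
in order that the kernel of the extension be open again. *)
Definition extendable
    (K : forall X B : linTopType k, (X -> B -> Prop) -> Prop) :=
  forall X B (R : X -> B -> Prop), K X B R -> slice_open_r R /\
    exists P Q, orthogonal R P Q /\
      forall C (R' : X -> C -> Prop), rel_extension P R R' -> K X C R'.

Lemma star_extendable : extendable star_rel.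
Proof.
move=> X B R [[P [Q PQ]] Rr Rl]; split=> //; exists P, Q; split=> // C R'.
move=> [R'r [W PW] R'l]; split=> //; first by exists P, W.
move=> z; have [b bz] := R'l z; have [Pb Pb_b] := Rl b.
by exists (opensubI P Pb) => p /andP[pP pPb]; apply: bz => //; exact: Pb_b.
Qed.

Lemma left_extendable : extendable left_rel.
Proof.
move=> X B R [[P PB] Rr]; split=> //; exists P, (opensubT B); split=> // C R'.
move=> [R'r _ R'l]; split=> //; exists P => p z pP _.
by have [b bz] := R'l z; apply: bz => //; exact: PB.
Qed.

Lemma right_extendable : extendable right_rel.
Proof.
move=> X B R [[Q XQ] Rl]; split; first by move=> x; exists Q => q; exact: XQ.
exists (opensubT X), Q; split=> // C R' [R'r R'W R'l]; split=> // z.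
have [b bz] := R'l z; have [P Pb] := Rl b.
by exists P => p pP; apply: bz => //; exact: Pb.
Qed.

Lemma shriek_extendable : extendable shriek_rel.
Proof.
move=> X B R [[P PB] [Q XQ]]; split; first by move=> x; exists Q => q; exact: XQ.
exists (opensubT X), Q; split=> // C R' [R'r R'W R'l]; split=> //.
exists P => p z pP _.
by have [b bz] := R'l z; apply: bz => //; exact: PB.
Qed.

Definition rel_l X B (E : submodClosed (tensor X B)) : X -> B -> Prop :=
  fun x b => tprod x b \in E.
Definition rel_r X B (E : submodClosed (tensor X B)) : B -> X -> Prop :=
  fun b x => tprod x b \in E.

Lemma image_subP (U V : lmodType k) (E : submodClosed U) (Q : submodClosed V)
    (t : V -> U) :
  [set t q | q in [set` Q]] `<=` [set` E] <-> forall q, q \in Q -> t q \in E.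
Proof.
split=> [QE q qQ|QE _ [q qQ <-]]; last exact: QE.
by apply: QE; exists q.
Qed.

Lemma star_open_rel_l X B (E : submodClosed (tensor X B)) :
  star_open E <-> star_rel (rel_l E).
Proof.
split=> [] [[P [Q PQ]] Er El]; split.
- by exists P, Q; apply/tensor_subP.
- by move=> x; have [Y /image_subP YE] := Er x; exists Y.
- by move=> b; have [Y /image_subP YE] := El b; exists Y.
- by exists P, Q; apply/tensor_subP.
- by move=> x; have [Y YE] := Er x; exists Y; apply/image_subP.
- by move=> b; have [Y YE] := El b; exists Y; apply/image_subP.
Qed.

Lemma star_open_rel_r X B (E : submodClosed (tensor X B)) :
  star_open E <-> star_rel (rel_r E).
Proof.
rewrite star_open_rel_l; split=> [] [[P [Q PQ]] Er El]; split=> //;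
  by exists Q, P => q p qQ pP; exact: PQ.
Qed.

Lemma left_open_rel_l X B (E : submodClosed (tensor X B)) :
  left_open E <-> left_rel (rel_l E).
Proof.
split=> [] [[P PE] Er]; split.
- by exists P; apply/tensor_subP.
- by move=> x; have [Y /image_subP YE] := Er x; exists Y.
- by exists P; apply/tensor_subP.
- by move=> x; have [Y YE] := Er x; exists Y; apply/image_subP.
Qed.

Lemma left_open_rel_r X B (E : submodClosed (tensor X B)) :
  left_open E <-> right_rel (rel_r E).
Proof.
rewrite left_open_rel_l; split=> [] [[P PE] Er]; split=> //;
  by exists P => b p bT pP; exact: PE.
Qed.

Lemma shriek_open_rel_l X B (E : submodClosed (tensor X B)) :
  shriek_open E <-> shriek_rel (rel_l E).
Proof.
rewrite shriek_openP; split=> [[P [Q [PE QE]]]|[[P PE] [Q QE]]].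
  by split; [exists P | exists Q]; apply/tensor_subP.
by exists P, Q; split; apply/tensor_subP.
Qed.

Lemma shriek_open_rel_r X B (E : submodClosed (tensor X B)) :
  shriek_open E <-> shriek_rel (rel_r E).
Proof.
rewrite shriek_open_rel_l; split=> [] [[P PE] [Q QE]]; split;
  by [exists P => b p bT pP; exact: PE | exists Q => b p bT pP; exact: QE].
Qed.

End Relations.

(** * Tensor products with one argument fixed *)

Section OneSidedTensor.
Context {k : fieldType}.

(** An interface for the topologized tensor product as a functor of one argument,
the other one being [X], so as to treat both sides at once. [K] says when a
subspace is open, in terms of the pure tensors that it contains. *)
Record one_sided_tensor (X : linTopType k)
    (K : forall B : linTopType k, (X -> B -> Prop) -> Prop) := OneSidedTensor {
  ost : linTopType k -> linTopType k;
  ostp : forall B : linTopType k, X -> B -> ost B;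
  ostpl : forall (B : linTopType k) (b : B), linear ((@ostp B)^~ b);
  ostpr : forall (B : linTopType k) x, linear (@ostp B x);
  ost_ind : forall (B : linTopType k) (S : ost B -> Prop), S 0 ->
    (forall a x b t, S t -> S (a *: ostp x b + t)) -> forall t, S t;
  ost_lift : forall (B : linTopType k) (D : lmodType k) (h : X -> B -> D),
    (forall b, linear (h^~ b)) -> (forall x, linear (h x)) ->
    exists phi : {linear ost B -> D}, forall x b, phi (ostp x b) = h x b;
  ost_map : forall B C : linTopType k, hom B C -> hom (ost B) (ost C);
  ost_mapE : forall (B C : linTopType k) (g : hom B C) x b,
    ost_map g (ostp x b) = ostp x (g b);
  ost_openP : forall (B : linTopType k) (E : submodClosed (ost B)),
    open [set` E] <-> K B (fun x b => ostp x b \in E)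
}.

Context {K : forall X B : linTopType k, (X -> B -> Prop) -> Prop}.
Hypothesis Kext : extendable K.
Context {X : linTopType k} (O : one_sided_tensor (@K X)).
Implicit Types A B C : linTopType k.

Let ostpB B x (b b' : B) : ostp O x (b - b') = ostp O x b - ostp O x b'.
Proof. exact: (linearB (mklinear (@ostpr _ _ O B x))). Qed.

Let ost_mapP B C (g : hom B C) a x b t :
  ost_map O g (a *: ostp O x b + t) = a *: ostp O x (g b) + ost_map O g t.
Proof. by rewrite homP ost_mapE. Qed.

(** [E'] is the kernel of the linear map induced by [h]: it pulls back to [E]
because [h] extends the projection modulo [E]. *)
Lemma ost_open_extension B C (g : hom B C) (E : opensub (ost O B)) :
    (forall P Q, orthogonal (fun x b => ostp O x b \in E) P Q -> exists h,
      bilinear_extension g (fun x b => \pi_(lquot E) (ostp O x b)) P h) ->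
  exists E' : opensub (ost O C), forall t, ost_map O g t \in E' -> t \in E.
Proof.
have /ost_openP/Kext[_ [P [Q [PQ KP]]]] := opensub_open E.
move=> /(_ P Q PQ)[h [[hl hr] hg hs [W hW] hz]].
have [phi phiE] := ost_lift O hl hr.
have phiP x z : ostp O x z \in presub phi sub0 <-> h x z = 0.
  by rewrite presubE phiE inE; split=> /eqP.
have oE' : open [set` presub phi sub0].
  apply/ost_openP/KP; split.
  - by move=> x; have [Y Yx] := hs x; exists Y => y /Yx /phiP.
  - by exists W => p w pP wW; apply/phiP; exact: hW.
  - move=> z; have [b bz] := hz z; exists b => p pP /lquot_eq0 pb.
    by apply/phiP; rewrite bz.
exists (OpenSub oE') => t; rewrite presubE inE => /eqP.
have -> : phi (ost_map O g t) = \pi_(lquot E) t.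
  elim/(@ost_ind _ _ O B): t => [|a x b t IH]; first by rewrite !linear0 lquot0.
  by rewrite ost_mapP linearP IH phiE hg lquotD lquotZ.
by move/lquot_eq0.
Qed.

(** The density holds because [x \otimes z] is continuous in [z], whichever the
topology. *)
Lemma ost_dense_quotient A B C (f : hom A B) (c : hom B C) :
  dense_quotient f c -> dense_quotient (ost_map O f) (ost_map O c).
Proof.
move=> fc; have [cf dc qc] := fc; split.
- elim/(@ost_ind _ _ O A) => [|a x b t IH]; first by rewrite !linear0.
  by rewrite !ost_mapP cf IH addr0 -(subrr 0) ostpB subrr scaler0.
- move=> E; elim/(@ost_ind _ _ O C) => [|a x z t [s sE]].
    by exists 0; rewrite linear0 subr0 rpred0.
  have /ost_openP/Kext[/(_ x)[Q QE] _] := opensub_open E.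
  have [b bQ] := dc Q z; exists (a *: ostp O x b + s).
  rewrite ost_mapP opprD addrACA -scalerBr rpredD ?rpredZ//.
  by rewrite -ostpB; exact: QE.
- move=> E fE; apply: ost_open_extension => P Q PQ.
  have /ost_openP/Kext[Er _] := opensub_open E.
  apply: (dense_quotient_bilinear_extension _ _ _ (Q := Q) _ fc).
  + by move=> b a x y; rewrite ostpl lquotD lquotZ.
  + by move=> x a b b'; rewrite ostpr lquotD lquotZ.
  + by move=> x; have [U UE] := Er x; exists U => b /UE bE; apply/lquot_eq0.
  + by move=> p q pP qQ; apply/lquot_eq0; exact: PQ.
  + by move=> x a; apply/lquot_eq0; rewrite -ost_mapE.
Qed.

Lemma ost_embedding A B (i : hom A B) :
  embedding i -> embedding (ost_map O i).
Proof.
move=> ei E; apply: ost_open_extension => P Q PQ.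
have /ost_openP/Kext[Er _] := opensub_open E.
apply: (embedding_bilinear_extension _ _ _ (Q := Q)) => //.
+ by move=> b a x y; rewrite ostpl lquotD lquotZ.
+ by move=> x a b b'; rewrite ostpr lquotD lquotZ.
+ by move=> x; have [U UE] := Er x; exists U => b /UE bE; apply/lquot_eq0.
+ by move=> p q pP qQ; apply/lquot_eq0; exact: PQ.
Qed.

Lemma completed_ost_cokernel (A B C : topSCType k) (f : hom A B) (c : hom B C) :
  is_cokernel c f ->
  is_cokernel (completion_map (ost_map O c)) (completion_map (ost_map O f)).
Proof.
move=> /cokernel_dense_quotient fc.
exact/dense_quotient_cokernel/completion_dense_quotient/ost_dense_quotient.
Qed.

Lemma completed_ost_Ex1 (A B C : topSCType k) (i : hom A B) (p : hom B C) :
  Ex1 i p ->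
  Ex1 (completion_map (ost_map O i)) (completion_map (ost_map O p)).
Proof.
move=> [ki cp]; split; last exact: completed_ost_cokernel.
apply: embedding_kernel.
  exact/completion_dense_quotient/ost_dense_quotient/cokernel_dense_quotient.
apply/completion_embedding/ost_embedding; exact: kernel_embedding ki.
Qed.

End OneSidedTensor.

(** * The three completed tensor products *)

Section Sides.
Context {k : fieldType} (T : tensor_topology k).
Context (K : forall X B : linTopType k, (X -> B -> Prop) -> Prop).
Hypothesis Kext : extendable K.

Section Left.
Hypothesis topenP : forall (X B : linTopType k) (E : submodClosed (tensor X B)),
  topen T E <-> K (fun x b => tprod x b \in E).

Definition left_tensor (X : linTopType k) : one_sided_tensor (@K X).
Proof.
apply: (@OneSidedTensor k X (@K X) (ttensor T X) (fun B x b => tprod x b)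
  _ _ _ _ (fun B C g => ttensor_map T (hom_id X) g)).
- by move=> B b a x y; exact: tprodPl.
- by move=> B x a b b'; exact: tprodPr.
- by move=> B; exact: tensor_ind.
- move=> B D h hl hr; exists (mklinear (tensor_lift_linear hl hr)).
  exact: tensor_lift_tprod.
- by move=> B C g x b; exact: tensor_map_tprod.
- by move=> B E; rewrite -topenP; exact: open_ttensorP.
Defined.

Lemma left_preserves (X : topSCType k) :
  preserves_cokernels (fix_left (completed_tensor T) X) /\
  preserves_Ex1 (fix_left (completed_tensor T) X).
Proof.
split=> A B C f c.
  exact: (completed_ost_cokernel Kext (left_tensor X)).
exact: (completed_ost_Ex1 Kext (left_tensor X)).
Qed.

End Left.

Section Right.
Hypothesis topenP : forall (X B : linTopType k) (E : submodClosed (tensor B X)),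
  topen T E <-> K (fun x b => tprod b x \in E).

Definition right_tensor (X : linTopType k) : one_sided_tensor (@K X).
Proof.
apply: (@OneSidedTensor k X (@K X) (fun B => ttensor T B X)
  (fun B x b => tprod b x)
  _ _ _ _ (fun B C g => ttensor_map T g (hom_id X))).
- by move=> B b a x y; exact: tprodPr.
- by move=> B x a b b'; exact: tprodPl.
- by move=> B S S0 SP; apply: tensor_ind => // a b x t; exact: SP.
- move=> B D h hl hr.
  exists (mklinear (@tensor_lift_linear k B X _ (fun b x => h x b) hr hl)).
  by move=> x b; exact: (@tensor_lift_tprod k B X _ (fun b x => h x b)).
- by move=> B C g x b; exact: tensor_map_tprod.
- by move=> B E; rewrite -topenP; exact: open_ttensorP.
Defined.

Lemma right_preserves (X : topSCType k) :
  preserves_cokernels (fix_right (completed_tensor T) X) /\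
  preserves_Ex1 (fix_right (completed_tensor T) X).
Proof.
split=> A B C f c.
  exact: (completed_ost_cokernel Kext (right_tensor X)).
exact: (completed_ost_Ex1 Kext (right_tensor X)).
Qed.

End Right.
End Sides.

Theorem proposition13p7 (k : fieldType) :
  (* (a) *)
  (forall X : topSCType k,
    [/\ preserves_cokernels (fix_left (completed_star k) X),
        preserves_cokernels (fix_right (completed_star k) X),
        preserves_Ex1 (fix_left (completed_star k) X) &
        preserves_Ex1 (fix_right (completed_star k) X)]) /\
  (* (b) *)
  (forall X : topSCType k,
    [/\ preserves_cokernels (fix_left (completed_left k) X),
        preserves_cokernels (fix_right (completed_left k) X),
        preserves_Ex1 (fix_left (completed_left k) X) &
        preserves_Ex1 (fix_right (completed_left k) X)]) /\
  (* (c) *)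
  (forall X : topSCType k,
    [/\ preserves_cokernels (fix_left (completed_shriek k) X),
        preserves_cokernels (fix_right (completed_shriek k) X),
        preserves_Ex1 (fix_left (completed_shriek k) X) &
        preserves_Ex1 (fix_right (completed_shriek k) X)]).
Proof.
have both (T : tensor_topology k) Kl Kr : extendable Kl -> extendable Kr ->
    (forall (X B : linTopType k) (E : submodClosed (tensor X B)),
      topen T E <-> Kl X B (rel_l E)) ->
    (forall (X B : linTopType k) (E : submodClosed (tensor B X)),
      topen T E <-> Kr X B (rel_r E)) ->
    forall X : topSCType k,
      [/\ preserves_cokernels (fix_left (completed_tensor T) X),
          preserves_cokernels (fix_right (completed_tensor T) X),
          preserves_Ex1 (fix_left (completed_tensor T) X) &
          preserves_Ex1 (fix_right (completed_tensor T) X)].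
  move=> lK rK TKl TKr X.
  have [lc le] := left_preserves lK TKl X.
  by have [rc re] := right_preserves rK TKr X.
split; last split.
- apply: (both (@star_topology k) _ _ star_extendable star_extendable) => X B E.
    exact: star_open_rel_l.
  exact: star_open_rel_r.
- apply: (both (@left_topology k) _ _ left_extendable right_extendable) => X B E.
    exact: left_open_rel_l.
  exact: left_open_rel_r.
- apply: (both (@shriek_topology k) _ _ shriek_extendable shriek_extendable)
    => X B E.
    exact: shriek_open_rel_l.
  exact: shriek_open_rel_r.
Qed.
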